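(* For every $\epsilon>0$ there is $C_\epsilon$ such that for all $N\ge1$ and all $\phi\in L^2(\mathcal{M})$, $$\|e^{it\Box}P_{\le N}\phi\|_{L^4_{t,\mathbf{x}}([0,1]\times\mathcal{M})}\le C_\epsilon N^{\epsilon}\|P_{\le N}\phi\|_{L^2(\mathcal{M})}.$$
   Context: $\mathcal{M}=\mathbb{R}\times\mathbb{T}$, $\mathbb{T}=\mathbb{R}/\mathbb{Z}$, $\mathbf{x}=(x,y)$. Fourier transform $\widehat f(\xi,k)=\int_{\mathcal{M}}e^{-2\pi i(\xi x+ky)}f\,dx\,dy$, $(\xi,k)\in\mathbb{R}\times\mathbb{Z}$. $\Box=\partial_x^2-\partial_y^2$ and $e^{it\Box}$ is the Fourier multiplier $e^{-4\pi^2it(\xi^2-k^2)}$. $\varphi$ is a fixed smooth radial function on $\mathbb{R}$ equal to $1$ on $|x|\le1$ and $0$ on $|x|\ge2$; $P_{\le N}$ is the Fourier multiplier $\varphi(\xi/N)\varphi(k/N)$. *)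

(* Defs.v *)
From HB Require Import structures.
From mathcomp Require Import all_boot all_order all_algebra.
From mathcomp Require Import all_classical all_reals all_analysis.
Set Implicit Arguments. Unset Strict Implicit. Unset Printing Implicit Defensive.
Import Order.TTheory GRing.Theory Num.Theory numFieldNormedType.Exports.
Local Open Scope classical_set_scope.
Local Open Scope ring_scope.

(* Conventions.  M = R x T with T = R/Z; a function on T is represented by its
   values on [0,1] (one period), and the Haar measure on T by Lebesgue measure
   on [0,1].  A complex-valued function is given by its real part and its
   imaginary part.  Fourier variables: (xi, k) in R x Z. *)

Section Defs.
Variable R : realType.
Notation mu := (@lebesgue_measure R).

Definition smooth (f : R -> R) : Prop :=
  forall (n : nat) (x : R), derivable (derive1n n f) x 1.

Definition cutoff (chi : R -> R) : Prop :=
  [/\ smooth chi, (forall x, chi (- x) = chi x),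
      (forall x, `|x| <= 1 -> chi x = 1) & (forall x, 2 <= `|x| -> chi x = 0)].

Definition L2M (a b : R -> R -> R) : Prop :=
  [/\ measurable_fun [set: R * R] (fun p : R * R => a p.1 p.2),
      measurable_fun [set: R * R] (fun p : R * R => b p.1 p.2) &
      (\int[mu]_x \int[mu]_(y in `[0%R, 1%R]) ((a x y) ^+ 2 + (b x y) ^+ 2)%:E
        < +oo)%E].

(* Fourier transform of the truncation (a + i b) 1_{|x| <= n} (an L^1 function):
   int_{[-n,n] x T} e^{-2 pi i (xi x + k y)} (a + i b)(x,y) dx dy,
   real and imaginary parts. *)
Definition phase (xi x : R) (k : int) (y : R) : R :=
  2 * pi * (xi * x + k%:~R * y).

Definition trunc_FT_re (a b : R -> R -> R) (n : nat) (xi : R) (k : int) : R :=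
  Rintegral mu `[- n%:R, n%:R] (fun x =>
    Rintegral mu `[0%R, 1%R] (fun y =>
      a x y * cos (phase xi x k y) + b x y * sin (phase xi x k y))).

Definition trunc_FT_im (a b : R -> R -> R) (n : nat) (xi : R) (k : int) : R :=
  Rintegral mu `[- n%:R, n%:R] (fun x =>
    Rintegral mu `[0%R, 1%R] (fun y =>
      b x y * cos (phase xi x k y) - a x y * sin (phase xi x k y))).

(* (Fr + i Fi) : R x Z -> C is the (L^2, Plancherel) Fourier transform of a + i b:
   it is the L^2(R x Z) limit of the Fourier transforms of the truncations. *)
Definition is_FT (a b : R -> R -> R) (Fr Fi : R -> int -> R) : Prop :=
  [/\ forall k, measurable_fun [set: R] (Fr ^~ k),
      forall k, measurable_fun [set: R] (Fi ^~ k) &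
      (fun n : nat =>
        (\esum_(k in [set: int]) \int[mu]_xi
           (((trunc_FT_re a b n xi k - Fr xi k) ^+ 2
             + (trunc_FT_im a b n xi k - Fi xi k) ^+ 2)%:E))%E)
      @ \oo --> 0%E].

(* e^{it Box} P_{<=N} phi (x, y), where Fr + i Fi = \hat phi:
     sum_k int e^{2 pi i (xi x + k y)} e^{-4 pi^2 i t (xi^2 - k^2)}
            chi(xi/N) chi(k/N) \hat phi(xi,k) dxi.
   The sum over k in Z is written over |k| <= K with K = trunc(2N) + 1, which
   contains the support of k |-> chi(k/N) (all other terms vanish). *)
Definition sphase (t x y xi : R) (k : int) : R :=
  2 * pi * (xi * x + k%:~R * y) - 4 * pi ^+ 2 * t * (xi ^+ 2 - k%:~R ^+ 2).

Definition bigK (N : R) : nat := (Num.truncn (2 * N)).+1.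

Definition kof (N : R) (j : nat) : int := j%:Z - (bigK N)%:Z.

Definition evol_re (chi : R -> R) (N : R) (Fr Fi : R -> int -> R) (t x y : R) : R :=
  \sum_(0 <= j < (2 * bigK N).+1)
    Rintegral mu [set: R] (fun xi =>
      chi (xi / N) * chi ((kof N j)%:~R / N) *
      (Fr xi (kof N j) * cos (sphase t x y xi (kof N j))
       - Fi xi (kof N j) * sin (sphase t x y xi (kof N j)))).

Definition evol_im (chi : R -> R) (N : R) (Fr Fi : R -> int -> R) (t x y : R) : R :=
  \sum_(0 <= j < (2 * bigK N).+1)
    Rintegral mu [set: R] (fun xi =>
      chi (xi / N) * chi ((kof N j)%:~R / N) *
      (Fr xi (kof N j) * sin (sphase t x y xi (kof N j))
       + Fi xi (kof N j) * cos (sphase t x y xi (kof N j)))).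

Definition L4norm_evol chi N Fr Fi : \bar R :=
  ((\int[mu]_(t in `[0%R, 1%R]) \int[mu]_x \int[mu]_(y in `[0%R, 1%R])
     (((evol_re chi N Fr Fi t x y) ^+ 2 + (evol_im chi N Fr Fi t x y) ^+ 2) ^+ 2)%:E)
   `^ (4%:R)^-1)%E.

(* || P_{<=N} phi ||_{L^2(M)}  (P_{<=N} phi = evolution at t = 0) *)
Definition L2norm_P chi N Fr Fi : \bar R :=
  ((\int[mu]_x \int[mu]_(y in `[0%R, 1%R])
     ((evol_re chi N Fr Fi 0 x y) ^+ 2 + (evol_im chi N Fr Fi 0 x y) ^+ 2)%:E)
   `^ (2%:R)^-1)%E.

End Defs.

(* Main.v *)
Require Import Defs.
From HB Require Import structures.
From mathcomp Require Import all_boot all_order all_algebra.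
From mathcomp Require Import all_classical all_reals all_analysis.
From mathcomp Require Import measurable_realfun ring lra.
Import Order.TTheory GRing.Theory Num.Theory numFieldNormedType.Exports.
Local Open Scope classical_set_scope.
Local Open Scope ring_scope.
Set Implicit Arguments. Unset Strict Implicit. Unset Printing Implicit Defensive.

(* Write [u = e^{it Box} P_{<=N} phi] and [|u|^4 = |u^2|^2].  Replacing the
   cutoffs in [t] and [x] by the weights [e^{-|t|}] and [e^{-del |x|}], whose
   Fourier transforms are Poisson kernels, the weighted integral of [|u^2|^2]
   becomes a quadratic form in [g (x) g], [g] being the localized Fourier
   transform of [phi].  By Schur's test it is at most [A |g|^4] where [A] bounds
     sum_k int P_del(s0 - xi - xi') P_1(t0 - xi^2 - xi'^2 + k^2 + (l - k)^2),
   uniformly in [s0], [t0], [l].  For a fixed value of [xi + xi'] the integral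
   over the remaining variable is [O(1 / (1 + ||k - l/2| - d|))] for some [d],
   so that [A] is a harmonic sum of length [O(N)], hence [O(log N)].  Letting
   [del] tend to 0 removes the weight in [x].  The same expansion of the weighted
   L^2 norm at time 0, together with the approximation of [g] by the Fourier
   transforms of the truncations of [phi], bounds [|g|] by [|P_{<=N} phi|]. *)

(** * Iterated integrals and the Gram expansion *)

(** The weights are chosen for their Fourier transforms, which are explicit and nonnegative, whereas
    sharp cutoffs in [t] and [x] would give sign-changing kernels. In [y] the sharp cutoff to one
    period is harmless: the frequencies are integers, and it yields a Kronecker delta. As [P_del]
    has mass 1 for every [del], [A] does not depend on [del], and the limit in [x] is free; dropping
    the weight in [t] costs a factor [e]. The logarithm arises as follows. With the sums [s] of the
    real and [l] of the integer frequencies fixed, completing squares turns the phase into a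
    multiple of [a^2 - m] with [m = tau + (k - l/2)^2]. The set where [|a^2 - m| <= 1] has measure
    of order [(1 + |m|)^(-1/2)], and [|m|^(1/2)] is at least the distance from [k - l/2] to one of
    the points [sqrt |tau|], [- sqrt |tau|]. Since the [k] are spaced by 1, this gives a harmonic
    sum. The loss [N^eps] is the fourth root of the power [N^(4 eps)] that replaces the logarithm.
    The norm on the right is taken in physical space while Schur's test produces [|g|]; hence the
    separate lower bound at time 0. *)

Lemma measurable_cos (R : realType) : measurable_fun [set: R] (@cos R).
Proof. by apply: continuous_measurable_fun; exact: continuous_cos. Qed.

Lemma measurable_sin (R : realType) : measurable_fun [set: R] (@sin R).
Proof. by apply: continuous_measurable_fun; exact: continuous_sin. Qed.

(* The canonical structure found on [m1 \x m2] requires probabilities; [prodm]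
   carries the sigma-finite one, so that products can be iterated. *)
Section product_integrals.
Context (d1 d2 : measure_display) (T1 : measurableType d1) (T2 : measurableType d2)
  (R : realType).
Variables (m1 : {sigma_finite_measure set T1 -> \bar R})
  (m2 : {sigma_finite_measure set T2 -> \bar R}).

Let prod_sigma_finite : sigma_finite setT (m1 \x m2)%E.
Proof.
have /sigma_finiteP[F [TF ndF Foo]] := sigma_finiteT m1.
have /sigma_finiteP[G [TG ndG Goo]] := sigma_finiteT m2.
exists (fun n => F n `*` G n).
  rewrite -setXTT TF TG predeqE => -[x y]; split.
    move=> [/= [n _ Fnx] [k _ Gky]]; exists (maxn n k) => //; split.
    - by move: x Fnx; exact/subsetPset/ndF/leq_maxl.
    - by move: y Gky; exact/subsetPset/ndG/leq_maxr.
  by move=> [n _ []/= ? ?]; split; exists n.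
move=> k; have [? ?] := Foo k; have [? ?] := Goo k.
split; first exact: measurableX.
by rewrite product_measure1E// lte_mul_pinfty// ge0_fin_numE.
Qed.

Definition prodm : set (T1 * T2) -> \bar R := (m1 \x m2)%E.

HB.instance Definition _ := Measure.on prodm.

HB.instance Definition _ :=
  Measure_isSigmaFinite.Build _ _ _ prodm prod_sigma_finite.

Lemma integrable_tensor (f : T1 -> R) (h : T2 -> R) :
  m1.-integrable setT (EFin \o f) -> m2.-integrable setT (EFin \o h) ->
  prodm.-integrable setT (EFin \o (fun z => f z.1 * h z.2)).
Proof.
move=> intf inth.
have /measurable_EFinP mf := measurable_int _ intf.
have /measurable_EFinP mh := measurable_int _ inth.
have mfh : measurable_fun setT (EFin \o (fun z : T1 * T2 => f z.1 * h z.2)).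
  by apply/measurable_EFinP/measurable_funM; apply: measurableT_comp.
apply/(integrable12ltyP m1 m2 mfh) => /=.
under eq_integral => x _.
  under eq_integral => y _ do rewrite normrM EFinM.
  rewrite ge0_integralZl//; last first.
    by apply/measurable_EFinP; apply: measurableT_comp.
  over.
rewrite ge0_integralZr//.
- apply: lte_mul_pinfty; first exact: integral_ge0.
    rewrite ge0_fin_numE; last exact: integral_ge0.
    by case/integrableP : intf.
  by case/integrableP : inth.
- by apply/measurable_EFinP; apply: measurableT_comp.
- exact: integral_ge0.
Qed.

(** The inner [Rintegral] is a [fine], hence 0 where the integral of the section is infinite. By
    Fubini this happens on a null set only, so the outer integrands agree almost everywhere. *)
Lemma Rintegral12_prod (f : T1 * T2 -> R) :
  prodm.-integrable setT (EFin \o f) ->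
  \int[m1]_x \int[m2]_y f (x, y) = \int[prodm]_z f z.
Proof.
move=> intf; rewrite /Rintegral; congr fine.
rewrite -(integral12_prod_meas1 intf).
have intF := integrable_fubini_F intf.
have mF := measurable_int _ intF.
apply: ae_eq_integral => //.
  by apply/measurable_EFinP; apply: measurableT_comp mF.
have := integrable_ae measurableT intF.
by apply: filterS => x /= /(_ I) Fx _; rewrite fineK.
Qed.

Lemma Rintegral21_prod (f : T1 * T2 -> R) :
  prodm.-integrable setT (EFin \o f) ->
  \int[m2]_y \int[m1]_x f (x, y) = \int[prodm]_z f z.
Proof.
move=> intf; rewrite /Rintegral; congr fine.
rewrite -(integral21_prod_meas1 intf).
have mG := measurable_fubini_G intf.
apply: ae_eq_integral => //.
  by apply/measurable_EFinP; apply: measurableT_comp mG.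
have := ae_integrable2 intf.
by apply: filterS => x /= Fx _; rewrite fineK//; apply: integrable_fin_num.
Qed.

Lemma Rintegral_tensor (f : T1 -> R) (h : T2 -> R) :
  m1.-integrable setT (EFin \o f) -> m2.-integrable setT (EFin \o h) ->
  \int[prodm]_z (f z.1 * h z.2) = \int[m1]_x f x * \int[m2]_y h y.
Proof.
move=> intf inth.
rewrite -(@Rintegral12_prod (fun z => f z.1 * h z.2)) /=; last first.
  exact: integrable_tensor.
by under eq_Rintegral => x _ do rewrite RintegralZl//; rewrite RintegralZr.
Qed.

(** Tonelli applies to the positive and negative parts separately; their difference and its [fine]
    are then measurable, whether or not the integrals converge. *)
Lemma measurable_Rintegral (f : T1 * T2 -> R) : measurable_fun setT f ->
  measurable_fun setT (fun x => \int[m2]_y f (x, y)).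
Proof.
move=> /measurable_EFinP mf; apply: measurableT_comp => //.
rewrite (_ : (fun _ => _) =
  (fun x => fubini_F m2 (EFin \o f)^\+ x - fubini_F m2 (EFin \o f)^\- x)%E).
  apply: emeasurable_funB; apply: measurable_fun_fubini_tonelli_F => //.
  - exact: measurable_funepos.
  - exact: measurable_funeneg.
apply/funext => x; rewrite integralE /fubini_F; congr (_ - _)%E.
  by apply: eq_integral => y _; rewrite !funeposE.
by apply: eq_integral => y _; rewrite !funenegE.
Qed.

Lemma ge0_integral12_prod (f : T1 * T2 -> \bar R) : measurable_fun setT f ->
  (forall z, 0 <= f z)%E ->
  (\int[prodm]_z f z = \int[m1]_x \int[m2]_y f (x, y))%E.
Proof. exact: fubini_tonelli1. Qed.

Lemma ge0_integral21_prod (f : T1 * T2 -> \bar R) : measurable_fun setT f ->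
  (forall z, 0 <= f z)%E ->
  (\int[prodm]_z f z = \int[m2]_y \int[m1]_x f (x, y))%E.
Proof. exact: fubini_tonelli2. Qed.

End product_integrals.

Lemma integrable_bounded_mul (d : measure_display) (T : measurableType d) (R : realType)
    (m : {measure set T -> \bar R}) (f h : T -> R) :
  m.-integrable setT (EFin \o f) -> measurable_fun setT h -> (forall x, `|h x| <= 1) ->
  m.-integrable setT (EFin \o (fun x => f x * h x)).
Proof.
move=> intf mh h1; have /measurable_EFinP mf := measurable_int _ intf.
apply: le_integrable intf => //; first by apply/measurable_EFinP/measurable_funM.
by move=> x _ /=; rewrite lee_fin normrM ler_piMr.
Qed.

Lemma Rintegral_sum (d : measure_display) (T : measurableType d) (R : realType)
    (m : {measure set T -> \bar R}) (I : Type) (s : seq I) (f : I -> T -> R) :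
  (forall i, m.-integrable setT (EFin \o f i)) ->
  \int[m]_x (\sum_(i <- s) f i x) = \sum_(i <- s) \int[m]_x f i x.
Proof.
move=> intf; rewrite /Rintegral.
under eq_integral => x _ do rewrite -sumEFin.
rewrite integral_sum// [RHS](_ : _ = fine (\sum_(i <- s) (\int[m]_x (f i x))%:E)).
  congr fine; apply: eq_bigr => i _; rewrite /Rintegral fineK//.
  exact: integrable_fin_num (intf i).
by rewrite sumEFin.
Qed.

Section gram.
Context (dY dZ : measure_display) (Y : measurableType dY) (Z : measurableType dZ)
  (R : realType).
Variables (mY : {sigma_finite_measure set Y -> \bar R})
  (mZ : {sigma_finite_measure set Z -> \bar R}).
Variables (I : finType) (W : Y -> R) (g : I -> Z -> R) (th : I -> Y -> Z -> R).
Hypothesis intW : mY.-integrable setT (EFin \o W).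
Hypothesis intg : forall i, mZ.-integrable setT (EFin \o g i).
Hypothesis mth : forall i, measurable_fun setT (fun p : Y * Z => th i p.1 p.2).

(** [osc_cos + i osc_sin] is the oscillatory integral [sum_i int g_i e^(i th_i)]. The amplitudes are
    real, so its squared modulus only involves cosines of phase differences. *)
Definition osc_cos y := \sum_i \int[mZ]_z (g i z * cos (th i y z)).
Definition osc_sin y := \sum_i \int[mZ]_z (g i z * sin (th i y z)).
Definition gram_kernel i j (z : Z * Z) :=
  \int[mY]_y (W y * cos (th i y z.1 - th j y z.2)).

Let mth2 i y : measurable_fun setT (th i y).
Proof. exact: (measurableT_comp (mth i) (pair1_measurable y)). Qed.

Let int_cos i y : mZ.-integrable setT (EFin \o (fun z => g i z * cos (th i y z))).
Proof.
apply: integrable_bounded_mul => //; last by move=> x; exact: cos_max.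
by apply: measurableT_comp (mth2 i y); exact: measurable_cos.
Qed.

Let int_sin i y : mZ.-integrable setT (EFin \o (fun z => g i z * sin (th i y z))).
Proof.
apply: integrable_bounded_mul => //; last by move=> x; exact: sin_max.
by apply: measurableT_comp (mth2 i y); exact: measurable_sin.
Qed.

Let F i j (p : Y * (Z * Z)) : R :=
  W p.1 * (g i p.2.1 * g j p.2.2) * cos (th i p.1 p.2.1 - th j p.1 p.2.2).

Let intF i j : (prodm mY (prodm mZ mZ)).-integrable setT (EFin \o F i j).
Proof.
apply: (integrable_bounded_mul
  (f := fun p : Y * (Z * Z) => W p.1 * (g i p.2.1 * g j p.2.2))
  (h := fun p => cos (th i p.1 p.2.1 - th j p.1 p.2.2))).
- exact: (integrable_tensor (h := fun z => g i z.1 * g j z.2) intW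
     (integrable_tensor (intg i) (intg j))).
- apply: measurableT_comp; first exact: measurable_cos.
  apply: measurable_funB.
    apply: (measurableT_comp (mth i) (g := fun p : Y * (Z * Z) => (p.1, p.2.1))).
    apply: measurable_fun_pair => //; exact: measurableT_comp.
  apply: (measurableT_comp (mth j) (g := fun p : Y * (Z * Z) => (p.1, p.2.2))).
  apply: measurable_fun_pair => //; exact: measurableT_comp.
- by move=> x; exact: cos_max.
Qed.

Let osc_sqr y : W y * (osc_cos y ^+ 2 + osc_sin y ^+ 2) =
  \sum_i \sum_j \int[prodm mZ mZ]_z F i j (y, z).
Proof.
rewrite /osc_cos /osc_sin !expr2 !mulr_suml -big_split mulr_sumr.
apply: eq_bigr => i _; rewrite !mulr_sumr -big_split mulr_sumr.
apply: eq_bigr => j _ /=.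
rewrite -!Rintegral_tensor// -RintegralD//; last 2 first.
  exact: (integrable_tensor (int_cos i y) (int_cos j y)).
  exact: (integrable_tensor (int_sin i y) (int_sin j y)).
rewrite -RintegralZl//; last first.
  have := integrableD measurableT (integrable_tensor (int_cos i y) (int_cos j y))
    (integrable_tensor (int_sin i y) (int_sin j y)).
  by apply: eq_integrable.
apply: eq_Rintegral => z _; rewrite /F /= cosB; ring.
Qed.

Let intFy i j : mY.-integrable setT
  (EFin \o (fun y => \int[prodm mZ mZ]_z F i j (y, z))).
Proof.
have intFF := integrable_fubini_F (intF i j).
have mF := measurable_int _ intFF.
apply: le_integrable intFF => //.
  by apply/measurable_EFinP; apply: measurableT_comp mF.
(* [fine] sends infinite values to 0, so it never exceeds the modulus of the extended integral. *)
by move=> y _ /=; rewrite /Rintegral /fubini_F; case: integral => /=; rewrite ?leey ?normr0.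
Qed.

Lemma integrable_gram :
  mY.-integrable setT (EFin \o (fun y => W y * (osc_cos y ^+ 2 + osc_sin y ^+ 2))).
Proof.
under [X in integrable _ _ X]eq_fun => y do rewrite osc_sqr.
have := @integrable_sum _ _ _ mY setT measurableT _ (index_enum I) xpredT
  (fun i y => \sum_j (\int[prodm mZ mZ]_z F i j (y, z))%:E)%E.
have H (i : I) : mY.-integrable setT
    (fun y => \sum_j (\int[prodm mZ mZ]_z F i j (y, z))%:E)%E.
  by apply: (integrable_sum measurableT) => j _; exact: intFy.
move=> /(_ (fun i _ => H i)); apply: eq_integrable => // y _.
by rewrite /= -sumEFin; apply: eq_bigr => i _; rewrite sumEFin.
Qed.

(** Fubini exchanges the physical variable with the two frequency variables. It applies since [W],
    [g i] and [g j] are integrable and the cosine is bounded. *)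
Lemma Rintegral_gram :
  \int[mY]_y (W y * (osc_cos y ^+ 2 + osc_sin y ^+ 2)) =
  \sum_i \sum_j \int[prodm mZ mZ]_z (g i z.1 * g j z.2 * gram_kernel i j z).
Proof.
under eq_Rintegral => y _ do rewrite osc_sqr pair_big.
rewrite Rintegral_sum; last by move=> ij; exact: intFy.
rewrite pair_big; apply: eq_bigr => -[i j] _ /=.
rewrite Rintegral12_prod// -Rintegral21_prod//.
apply: eq_Rintegral => z _; rewrite /gram_kernel -RintegralZl//; last first.
  apply: integrable_bounded_mul => //; last by move=> x; exact: cos_max.
  apply: measurableT_comp; first exact: measurable_cos.
  apply: measurable_funB; [apply: (measurableT_comp (mth i) (pair2_measurable z.1))|
     apply: (measurableT_comp (mth j) (pair2_measurable z.2))].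
by apply: eq_Rintegral => y _; rewrite /F /=; ring.
Qed.

End gram.

(** * Schur's test *)

Section integral_bounds.
Context (d : measure_display) (T : measurableType d) (R : realType)
  (m : {measure set T -> \bar R}).
Local Open Scope ereal_scope.

(* No measurability is required: the integral of a nonnegative function is a
   supremum over the simple functions below it. *)
Lemma ge0_le_integral_nomeas (D : set T) (f h : T -> \bar R) :
  (forall x, D x -> 0 <= f x) -> (forall x, D x -> f x <= h x) ->
  \int[m]_(x in D) f x <= \int[m]_(x in D) h x.
Proof.
move=> f0 fh; rewrite integral_mkcond [leRHS]integral_mkcond.
have fD0 x : 0 <= (f \_ D) x.
  by rewrite patchE; case: ifPn => // /set_mem; exact: f0.
have fhD x : (f \_ D) x <= (h \_ D) x.
  by rewrite !patchE; case: ifPn => // /set_mem; exact: fh.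
rewrite !ge0_integralTE//; last by move=> x; exact: le_trans (fhD x).
apply: ub_ereal_sup => _ [s hs <-]; apply: ereal_sup_ubound; exists s => //= x.
exact: le_trans (hs x) (fhD x).
Qed.

Lemma normr_Rintegral_le (D : set T) (f : T -> R) (h : T -> \bar R) :
  (forall x, D x -> `|f x|%:E <= h x) ->
  `|Rintegral m D f|%:E <= \int[m]_(x in D) h x.
Proof.
move=> fh; rewrite /Rintegral integralE.
have hp : \int[m]_(x in D) (EFin \o f)^\+ x <= \int[m]_(x in D) h x.
  apply: ge0_le_integral_nomeas => // x Dx; apply: le_trans (fh _ Dx).
  by rewrite funeposE ge_max !lee_fin ler_norm normr_ge0.
have hn : \int[m]_(x in D) (EFin \o f)^\- x <= \int[m]_(x in D) h x.
  apply: ge0_le_integral_nomeas => // x Dx; apply: le_trans (fh _ Dx).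
  by rewrite funenegE ge_max -EFinN !lee_fin -normrN ler_norm normr_ge0.
have p0 : 0 <= \int[m]_(x in D) (EFin \o f)^\+ x by exact: integral_ge0.
have n0 : 0 <= \int[m]_(x in D) (EFin \o f)^\- x by exact: integral_ge0.
move: hp hn p0 n0; rewrite /comp.
move: (integral _ _ _^\+) (integral _ _ _^\-) (\int[m]_(x in D) h x).
move=> [a| |] [b| |] [c| |] //=; rewrite ?lee_fin ?leey// => ac bc a0 b0.
by rewrite ler_norml; lra.
Qed.

End integral_bounds.

Section schur.
Context (d : measure_display) (Z : measurableType d) (R : realType)
  (mZ : {sigma_finite_measure set Z -> \bar R}) (I : finType).
Variables (k : I -> I -> Z * Z -> R) (A : R).
Hypothesis k0 : forall i j z, 0 <= k i j z.
Hypothesis mk : forall i j, measurable_fun setT (k i j).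

Let ge0A_row (H : forall i z1,
  (\sum_j \int[mZ]_z2 (k i j (z1, z2))%:E <= A%:E)%E) (i : I) (z : Z) : 0 <= A.
Proof.
rewrite -lee_fin; apply: le_trans (H i z).
by apply: sume_ge0 => j _; apply: integral_ge0 => x _; rewrite lee_fin.
Qed.

(** The weight [h] depends on the first variable only, so integrating the second one first exposes
    the row sum of the kernel. *)
Lemma schur_row (h : I -> Z -> R) : (forall i z, 0 <= h i z) ->
  (forall i, measurable_fun setT (h i)) ->
  (forall i z1, (\sum_j \int[mZ]_z2 (k i j (z1, z2))%:E <= A%:E)%E) ->
  (\sum_i \sum_j \int[prodm mZ mZ]_z (h i z.1 * k i j z)%:E <=
   A%:E * \sum_i \int[mZ]_z (h i z)%:E)%E.
Proof.
move=> h0 mh H.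
rewrite ge0_sume_distrr; last first.
  by move=> i _; apply: integral_ge0 => x _; rewrite lee_fin.
apply: lee_sum => i _.
have mkx j z1 : measurable_fun setT (fun z2 => (k i j (z1, z2))%:E).
  by apply/measurable_EFinP; exact: (measurableT_comp (mk i j) (pair1_measurable z1)).
have mkj j : measurable_fun setT (fun z1 => \int[mZ]_z2 (k i j (z1, z2))%:E)%E.
  apply: (measurable_fun_fubini_tonelli_F (EFin \o k i j)) => //.
    exact/measurable_EFinP.
  by move=> x; rewrite lee_fin.
apply: (@le_trans _ _
  (\sum_j \int[mZ]_z1 ((h i z1)%:E * \int[mZ]_z2 (k i j (z1, z2))%:E))%E).
  apply: lee_sum => j _.
  rewrite (fubini_tonelli1 (fun z => (h i z.1 * k i j z)%:E)).
  - apply: ge0_le_integral_nomeas => x _.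
      by apply: integral_ge0 => y _; rewrite lee_fin mulr_ge0.
    rewrite /fubini_F /=; under eq_integral do rewrite EFinM.
    by rewrite ge0_integralZl// ?lee_fin// => y _; rewrite lee_fin.
  - apply/measurable_EFinP/measurable_funM => //; exact: measurableT_comp.
  - by move=> x; rewrite lee_fin mulr_ge0.
rewrite -ge0_integral_sum//; last 2 first.
  by move=> j; apply: emeasurable_funM => //; exact/measurable_EFinP.
  move=> j z _; apply: mule_ge0; first by rewrite lee_fin.
  by apply: integral_ge0 => y _; rewrite lee_fin.
(* The sign of [A] is read off a row bound at a point. If [Z] is empty there is no such point, but
   then all integrals vanish. *)
have [|z0] := pselect (exists z : Z, True); last first.
  rewrite integral0_eq ?integral0_eq ?mule0// => x _; exfalso; apply: z0; by exists x.
move=> [z _]; have A0 := ge0A_row H i z.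
rewrite -ge0_integralZl//; [|exact/measurable_EFinP|by move=> x _; rewrite lee_fin].
apply: ge0_le_integral_nomeas => x _.
  apply: sume_ge0 => j _; apply: mule_ge0; first by rewrite lee_fin.
  by apply: integral_ge0 => y _; rewrite lee_fin.
rewrite -ge0_sume_distrr; last by move=> j _; apply: integral_ge0 => y _; rewrite lee_fin.
by rewrite muleC; apply: lee_wpmul2r => //; rewrite lee_fin.
Qed.

End schur.

(** This is the row estimate for the transposed kernel [k'], with Tonelli read in the other
    order. *)
Lemma schur_col (d : measure_display) (Z : measurableType d) (R : realType)
    (mZ : {sigma_finite_measure set Z -> \bar R}) (I : finType)
    (k : I -> I -> Z * Z -> R) (A : R) (h : I -> Z -> R) :
  (forall i j z, 0 <= k i j z) -> (forall i j, measurable_fun setT (k i j)) ->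
  (forall i z, 0 <= h i z) -> (forall i, measurable_fun setT (h i)) ->
  (forall j z2, (\sum_i \int[mZ]_z1 (k i j (z1, z2))%:E <= A%:E)%E) ->
  (\sum_i \sum_j \int[prodm mZ mZ]_z (h j z.2 * k i j z)%:E <=
   A%:E * \sum_i \int[mZ]_z (h i z)%:E)%E.
Proof.
move=> k0 mk h0 mh H; rewrite exchange_big /=.
pose k' i j (z : Z * Z) := k j i (z.2, z.1).
have mk' i j : measurable_fun setT (k' i j).
  apply: (measurableT_comp (mk j i) (g := fun z : Z * Z => (z.2, z.1))).
  exact: measurable_fun_pair.
apply: le_trans (@schur_row _ _ _ mZ _ k' A _ mk' h h0 mh _) => //; last first.
  by move=> i j z; exact: k0.
apply: lee_sum => i _; apply: lee_sum => j _.
rewrite (fubini_tonelli2 (fun z => (h i z.2 * k j i z)%:E)); last 2 first.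
- apply/measurable_EFinP/measurable_funM => //; exact: measurableT_comp.
- by move=> x; rewrite lee_fin mulr_ge0.
rewrite (fubini_tonelli1 (fun z => (h i z.1 * k' i j z)%:E))//.
- apply/measurable_EFinP/measurable_funM => //; exact: measurableT_comp.
- by move=> x; rewrite lee_fin mulr_ge0// k0.
Qed.

(** By [2 |g_i g_j| <= g_i^2 + g_j^2] the form splits into a part weighted in the first variable and
    a part weighted in the second. Row sums control the former, column sums the latter, and each
    contributes half of the bound. *)
Lemma schur_test (d : measure_display) (Z : measurableType d) (R : realType)
    (mZ : {sigma_finite_measure set Z -> \bar R}) (I : finType)
    (kap k : I -> I -> Z * Z -> R) (A : R) (g : I -> Z -> R) :
  (forall i j z, `|kap i j z| <= k i j z) ->
  (forall i j, measurable_fun setT (k i j)) ->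
  (forall i, measurable_fun setT (g i)) ->
  (forall i, mZ.-integrable setT (EFin \o (fun z => g i z ^+ 2))) ->
  (forall i z1, (\sum_j \int[mZ]_z2 (k i j (z1, z2))%:E <= A%:E)%E) ->
  (forall j z2, (\sum_i \int[mZ]_z1 (k i j (z1, z2))%:E <= A%:E)%E) ->
  \sum_i \sum_j \int[prodm mZ mZ]_z (g i z.1 * g j z.2 * kap i j z) <=
  A * \sum_i \int[mZ]_z (g i z ^+ 2).
Proof.
move=> kapk mk mg ig2 Hr Hc.
have k0 i j z : 0 <= k i j z by exact: le_trans (kapk i j z).
pose h i z := g i z ^+ 2 / 2.
have h0 i z : 0 <= h i z by rewrite /h divr_ge0// sqr_ge0.
have mh i : measurable_fun setT (h i).
  by apply: measurable_funM => //; exact: measurable_funX.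
have hE : (\sum_i \int[mZ]_z (h i z)%:E)%E = (2^-1 * \sum_i \int[mZ]_z (g i z ^+ 2))%:E.
  rewrite mulr_sumr -sumEFin; apply: eq_bigr => i _.
  rewrite EFinM /Rintegral fineK; last exact: integrable_fin_num (ig2 i).
  rewrite -ge0_integralZl//; last 2 first.
    by apply/measurable_EFinP; exact: measurable_funX.
    by move=> z _; rewrite lee_fin sqr_ge0.
  by apply: eq_integral => z _; rewrite /h mulrC.
have Sr := schur_row k0 mk h0 mh Hr.
have Sc := schur_col k0 mk h0 mh Hc.
rewrite -lee_fin [X in (_ <= X)%E](_ : _ =
  A%:E * (\sum_i \int[mZ]_z (h i z)%:E) + A%:E * (\sum_i \int[mZ]_z (h i z)%:E))%E; last first.
  by rewrite hE -!EFinM -EFinD; congr EFin; field.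
apply: le_trans (leeD Sr Sc).
rewrite -big_split -sumEFin; apply: lee_sum => i _ /=.
rewrite -big_split -sumEFin; apply: lee_sum => j _ /=.
have mk1 : measurable_fun setT (fun z : Z * Z => (h i z.1 * k i j z)%:E).
  apply/measurable_EFinP/measurable_funM => //; exact: measurableT_comp.
have mk2 : measurable_fun setT (fun z : Z * Z => (h j z.2 * k i j z)%:E).
  apply/measurable_EFinP/measurable_funM => //; exact: measurableT_comp.
rewrite -ge0_integralD//; last 2 first.
  by move=> z _; rewrite lee_fin mulr_ge0.
  by move=> z _; rewrite lee_fin mulr_ge0.
apply: (@le_trans _ _ (`|\int[prodm mZ mZ]_z (g i z.1 * g j z.2 * kap i j z)|%:E)).
  by rewrite lee_fin ler_norm.
apply: normr_Rintegral_le => z _; rewrite -EFinD lee_fin normrM -mulrDl.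
apply: ler_pM => //; rewrite /h normrM.
rewrite -[g i z.1 ^+ 2]real_normK ?num_real// -[g j z.2 ^+ 2]real_normK ?num_real//.
have := sqr_ge0 (`|g i z.1| - `|g j z.2|); lra.
Qed.

(** * Squaring an oscillatory integral *)

Section oscillatory_square.
Context (dY dZ : measure_display) (Y : measurableType dY) (Z : measurableType dZ)
  (R : realType).
Variables (mZ : {sigma_finite_measure set Z -> \bar R}).
Variables (I : finType) (g : I -> Z -> R) (th : I -> Y -> Z -> R).
Hypothesis intg : forall i, mZ.-integrable setT (EFin \o g i).
Hypothesis mth : forall i, measurable_fun setT (fun p : Y * Z => th i p.1 p.2).

(** Squaring multiplies amplitudes and adds phases: the square is again an oscillatory integral,
    indexed by pairs, to which the Gram expansion applies. *)
Definition tensor2 (ij : I * I) (z : Z * Z) := g ij.1 z.1 * g ij.2 z.2.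
Definition phase2 (ij : I * I) (y : Y) (z : Z * Z) := th ij.1 y z.1 + th ij.2 y z.2.

Let mth2 i y : measurable_fun setT (th i y).
Proof. exact: (measurableT_comp (mth i) (pair1_measurable y)). Qed.

Let int_cos i y : mZ.-integrable setT (EFin \o (fun z => g i z * cos (th i y z))).
Proof.
apply: integrable_bounded_mul => //; last by move=> x; exact: cos_max.
by apply: measurableT_comp (mth2 i y); exact: measurable_cos.
Qed.

Let int_sin i y : mZ.-integrable setT (EFin \o (fun z => g i z * sin (th i y z))).
Proof.
apply: integrable_bounded_mul => //; last by move=> x; exact: sin_max.
by apply: measurableT_comp (mth2 i y); exact: measurable_sin.
Qed.

Lemma osc_cos2E y : osc_cos (prodm mZ mZ) tensor2 phase2 y =
  osc_cos mZ g th y ^+ 2 - osc_sin mZ g th y ^+ 2.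
Proof.
rewrite /osc_cos /osc_sin !expr2 !mulr_suml -sumrB -(pair_big xpredT xpredT (fun i j =>
  \int[prodm mZ mZ]_z (tensor2 (i, j) z * cos (phase2 (i, j) y z)))) /=.
apply: eq_bigr => i _; rewrite !mulr_sumr -sumrB; apply: eq_bigr => j _.
rewrite -!Rintegral_tensor// -RintegralB//; last 2 first.
  exact: (integrable_tensor (int_cos i y) (int_cos j y)).
  exact: (integrable_tensor (int_sin i y) (int_sin j y)).
by apply: eq_Rintegral => z _; rewrite /tensor2 /phase2 /= cosD; ring.
Qed.

Lemma osc_sin2E y : osc_sin (prodm mZ mZ) tensor2 phase2 y =
  2 * osc_cos mZ g th y * osc_sin mZ g th y.
Proof.
have -> : 2 * osc_cos mZ g th y * osc_sin mZ g th y =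
  osc_sin mZ g th y * osc_cos mZ g th y + osc_cos mZ g th y * osc_sin mZ g th y by ring.
rewrite /osc_cos /osc_sin !mulr_suml -big_split -(pair_big xpredT xpredT (fun i j =>
  \int[prodm mZ mZ]_z (tensor2 (i, j) z * sin (phase2 (i, j) y z)))) /=.
apply: eq_bigr => i _; rewrite !mulr_sumr -big_split; apply: eq_bigr => j _ /=.
rewrite -!Rintegral_tensor// -RintegralD//; last 2 first.
  exact: (integrable_tensor (int_sin i y) (int_cos j y)).
  exact: (integrable_tensor (int_cos i y) (int_sin j y)).
by apply: eq_Rintegral => z _; rewrite /tensor2 /phase2 /= sinD; ring.
Qed.

Lemma osc_sqr2 y :
  osc_cos (prodm mZ mZ) tensor2 phase2 y ^+ 2 + osc_sin (prodm mZ mZ) tensor2 phase2 y ^+ 2 =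
  (osc_cos mZ g th y ^+ 2 + osc_sin mZ g th y ^+ 2) ^+ 2.
Proof. by rewrite osc_cos2E osc_sin2E; ring. Qed.

Lemma tensor2_sqr : (forall i, mZ.-integrable setT (EFin \o (fun z => g i z ^+ 2))) ->
  \sum_ij \int[prodm mZ mZ]_z (tensor2 ij z ^+ 2) = (\sum_i \int[mZ]_z (g i z ^+ 2)) ^+ 2.
Proof.
move=> ig2; rewrite expr2 mulr_suml -(pair_big xpredT xpredT (fun i j =>
  \int[prodm mZ mZ]_z (tensor2 (i, j) z ^+ 2))) /=.
apply: eq_bigr => i _; rewrite mulr_sumr; apply: eq_bigr => j _.
rewrite -Rintegral_tensor//; apply: eq_Rintegral => z _.
by rewrite /tensor2 /= exprMn.
Qed.

End oscillatory_square.

(** * Integrals over the real line *)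

Section lebesgue_line.
Variable R : realType.
Notation mu := (@lebesgue_measure R).

Lemma lebesgue_measure_shift (c : R) (A : set R) : measurable A ->
  pushforward mu ((+%R c) : _ -> measurableTypeR R) A = mu A.
Proof.
move=> mA.
have mphi : measurable_fun setT (+%R c : measurableTypeR R -> measurableTypeR R).
  exact: measurable_funD.
pose phi : {mfun measurableTypeR R >-> measurableTypeR R} :=
  HB.pack (+%R c) (isMeasurableFun.Build _ _ _ _ _ mphi).
apply/esym; apply: (@lebesgue_measure_unique R (pushforward mu phi)) => //= _ [[a b]] _ <-.
rewrite /pushforward /= [X in _ = mu X](_ : _ = `]a - c, b - c]%classic); last first.
  by apply/seteqP; split => x /=; rewrite !in_itv/= ltrBlDl lerBrDl.
rewrite !lebesgue_measure_itv/= !lte_fin ltrD2r; case: ifPn => // _.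
by rewrite -!EFinD; congr EFin; ring.
Qed.

Local Open Scope ereal_scope.

Lemma ge0_integral_shift (f : R -> \bar R) (c : R) : measurable_fun [set: R] f ->
  (forall x, 0 <= f x) -> \int[mu]_x f (c + x)%R = \int[mu]_x f x.
Proof.
move=> mf f0.
have mphi : measurable_fun setT (+%R c : measurableTypeR R -> measurableTypeR R).
  exact: measurable_funD.
pose phi : {mfun measurableTypeR R >-> measurableTypeR R} :=
  HB.pack (+%R c) (isMeasurableFun.Build _ _ _ _ _ mphi).
transitivity (\int[pushforward mu phi]_x f x).
  by rewrite ge0_integral_pushforward// => x _.
by apply: eq_measure_integral => A mA _; exact: lebesgue_measure_shift.
Qed.

Lemma ge0_integral_reflect (f : R -> \bar R) (c : R) : measurable_fun [set: R] f ->
  (forall x, 0 <= f x) -> \int[mu]_x f (c - x)%R = \int[mu]_x f x.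
Proof.
move=> mf f0; rewrite -[RHS](ge0_integral_shift c)//.
have mg : measurable_fun [set: R] (fun x => f (c + x)%R).
  by apply: measurableT_comp mf _; exact: measurable_funD.
transitivity (\int[pushforward mu (-%R : _ -> measurableTypeR R)]_x f (c + x)%R).
  by rewrite ge0_integral_pushforward// => x _.
by apply: eq_measure_integral => A mA _; exact: lebesgue_measureN.
Qed.

Lemma Rintegral_odd (f : R -> R) : measurable_fun [set: R] f ->
  (forall x, f (- x) = - f x)%R -> (\int[mu]_x f x = 0)%R.
Proof.
move=> mf fN; rewrite /Rintegral integralE.
rewrite -(@ge0_integral_reflect (fun x => (f x)%:E)^\- 0%R)//; last first.
  by apply: measurable_funeneg; exact/measurable_EFinP.
rewrite [X in _ - X](_ : _ = \int[mu]_x (fun x => (f x)%:E)^\+ x).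
  (* If both parts have infinite integral, the difference is [-oo], whose [fine] is 0 as well. *)
  by case: (\int[mu]_x _) => //= r; rewrite subrr.
apply: eq_integral => x _; rewrite funenegE funeposE sub0r fN.
by rewrite EFinN oppeK.
Qed.

(** Evenness reduces to the half line, where the fundamental theorem of calculus holds with limit
    [l] at infinity. The derivative is taken at [x > 0], so that [F] can be written without absolute
    values. *)
Lemma ge0_even_integralT (f F : R -> R) (l : R) :
  (forall x, 0 <= f x)%R -> continuous f -> (forall x, f (- x) = f x)%R ->
  (forall x : R, 0 < x -> is_derive x 1 F (f x))%R -> {for 0%R, continuous F} ->
  F x @[x --> +oo%R] --> l ->
  \int[mu]_x (f x)%:E = (2 * (l - F 0))%:E.
Proof.
move=> f0 cf feven dF cF Fl.
rewrite ge0_symfun_integralT//; last by move=> x /=; rewrite feven.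
rewrite -set_itvcy (@ge0_continuous_FTC2y _ f F 0 l)//.
- exact: continuous_subspaceT.
- by move=> x x0; have [] := dF x x0.
- exact: cvg_at_right_filter.
- move=> x; rewrite in_itv/= andbT => x0; rewrite derive1E.
  by have d := dF x x0; rewrite derive_val.
Qed.


Local Close Scope ereal_scope.

Lemma integral_lorentz (b : R) : 0 < b ->
  (\int[mu]_x ((1 + (b * x) ^+ 2)^-1)%:E = (pi / b)%:E)%E.
Proof.
move=> b0; have b0' : b != 0 by rewrite gt_eqF.
have pos x : 0 < 1 + (b * x) ^+ 2 by rewrite ltr_pwDl// sqr_ge0.
have dF (x : R) : is_derive x 1 (fun x => atan (b * x) / b) ((1 + (b * x) ^+ 2)^-1).
  apply: is_derive_eq.
  by rewrite /GRing.scale /=; field; rewrite b0' (gt_eqF (pos x)).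
rewrite (_ : pi / b = 2 * (pi / 2 / b - atan (b * 0) / b)); last first.
  by rewrite mulr0 atan0; field.
apply: (@ge0_even_integralT _ (fun x => atan (b * x) / b) (pi / 2 / b)).
- by move=> x; rewrite invr_ge0 ltW.
- move=> x; apply: cvgV; first by rewrite gt_eqF.
  apply: cvgD; first exact: cvg_cst.
  apply: (@continuous_comp _ _ _ (fun x : R => b * x) (fun x => x ^+ 2)).
    exact: mulrl_continuous.
  exact: exprn_continuous.
- by move=> x; rewrite mulrN sqrrN.
- by apply/differentiable_continuous/derivable1_diffP; have [] := dF 0.
- apply: cvgMl; apply: (@cvg_comp _ _ _ (fun x => b * x) atan _ +oo).
    exact: gt0_cvgMry.
  exact: cvgy_atan.
Qed.

Lemma continuous_expabs (a : R) : continuous (fun x : R => expR (- a * `|x|)).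
Proof.
move=> x; apply: (@continuous_comp _ _ _ (fun x : R => - a * `|x|) expR).
  by apply: cvgMr; exact: norm_continuous.
exact: continuous_expR.
Qed.

Let cvg_expabs (a : R) : 0 < a -> expR (- a * x) @[x --> +oo] --> 0.
Proof.
move=> a0; rewrite (_ : (fun x => _) = (fun x => expR (- x)) \o (fun x => a * x)).
  by apply: cvg_comp; [exact: gt0_cvgMry cvg_id | exact: cvgr_expR].
by apply/funext => x /=; rewrite mulNr.
Qed.

Lemma integral_expabs (a : R) : 0 < a ->
  (\int[mu]_x (expR (- a * `|x|))%:E = (2 / a)%:E)%E.
Proof.
move=> a0; have a0' : a != 0 by rewrite gt_eqF.
have dF (x : R) : is_derive x 1 (fun x => - (expR (- a * x) / a)) (expR (- a * x)).
  by apply: is_derive_eq; rewrite /GRing.scale /=; field.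
rewrite (_ : 2 / a = 2 * (0 - - (expR (- a * 0) / a))); last first.
  by rewrite mulr0 expR0; field.
apply: (@ge0_even_integralT _ (fun x => - (expR (- a * x) / a)) 0).
- by move=> x; rewrite expR_ge0.
- exact: continuous_expabs.
- by move=> x; rewrite normrN.
- by move=> x x0; rewrite gtr0_norm//; exact: dF.
- by apply/differentiable_continuous/derivable1_diffP; have [] := dF 0.
- rewrite -oppr0; apply: cvgN; rewrite -[X in _ --> X](mul0r a^-1).
  by apply: cvgMl; exact: cvg_expabs.
Qed.

(** Adding 1 to the cosine makes the integrand nonnegative, as the half-line fundamental theorem
    asks; the integral of the bare exponential is subtracted afterwards. *)
Lemma integral_expabs1Dcos (a b : R) : 0 < a ->
  (\int[mu]_x (expR (- a * `|x|) * (1 + cos (b * x)))%:E =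
   (2 / a + 2 * a / (a ^+ 2 + b ^+ 2))%:E)%E.
Proof.
move=> a0; have a0' : a != 0 by rewrite gt_eqF.
have s0 : a ^+ 2 + b ^+ 2 != 0 by rewrite gt_eqF// ltr_pwDl// ?sqr_ge0// exprn_gt0.
pose F (x : R) := expR (- a * x) *
  ((b * sin (b * x) - a * cos (b * x)) / (a ^+ 2 + b ^+ 2) - a^-1).
have dF (x : R) : is_derive x 1 F (expR (- a * x) * (1 + cos (b * x))).
  by apply: is_derive_eq; rewrite /GRing.scale /=; field; rewrite s0 a0'.
rewrite (_ : _ + _ = 2 * (0 - F 0)); last first.
  by rewrite /F !mulr0 expR0 sin0 cos0; field; rewrite s0 a0'.
apply: (@ge0_even_integralT _ F 0).
- by move=> x; rewrite mulr_ge0 ?expR_ge0//; have := cos_geN1 (b * x); lra.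
- move=> x; apply: cvgM; first exact: continuous_expabs.
  apply: cvgD; first exact: cvg_cst.
  apply: (@continuous_comp _ _ _ (fun x : R => b * x) cos).
    exact: mulrl_continuous.
  exact: continuous_cos.
- by move=> x; rewrite normrN mulrN cosN.
- by move=> x x0; rewrite gtr0_norm//; exact: dF.
- by apply/differentiable_continuous/derivable1_diffP; have [] := dF 0.
(* [C] bounds the trigonometric factor of [F], which squeezes [F] between multiples of the decaying
   exponential. *)
- pose C := (`|b| + a) / (a ^+ 2 + b ^+ 2) + a^-1.
  apply: (@squeeze_cvgr _ _ _ _ (fun x => - (C * expR (- a * x)))
    (fun x => C * expR (- a * x))).
  + apply: nearW => x; rewrite -ler_norml /F normrM ger0_norm ?expR_ge0// mulrC.
    rewrite ler_wpM2r ?expR_ge0// /C (le_trans (ler_normB _ _))//.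
    rewrite (@ger0_norm _ a^-1) ?invr_ge0 ?(ltW a0)// lerD2r normrM.
    rewrite (@ger0_norm _ (_^-1)) ?invr_ge0 ?addr_ge0 ?sqr_ge0//.
    rewrite ler_wpM2r ?invr_ge0 ?addr_ge0 ?sqr_ge0//.
    rewrite (le_trans (ler_normB _ _))// !normrM (ger0_norm (ltW a0)).
    have := sin_max (b * x); have := cos_max (b * x) => h1 h2.
    by apply: lerD; rewrite ler_piMr// ltW.
  + rewrite -oppr0; apply: cvgN; rewrite -[X in _ --> X](mulr0 C).
    by apply: cvgMr; exact: cvg_expabs.
  + rewrite -[X in _ --> X](mulr0 C).
    by apply: cvgMr; exact: cvg_expabs.
Qed.

Lemma integrable_expabs (a : R) : 0 < a ->
  mu.-integrable setT (EFin \o (fun x => expR (- a * `|x|))).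
Proof.
move=> a0; apply/integrableP; split.
  by apply/measurable_EFinP; apply: continuous_measurable_fun; exact: continuous_expabs.
under eq_integral => x _ do rewrite /= ger0_norm ?expR_ge0//.
by rewrite integral_expabs// ltry.
Qed.

Lemma Rintegral_expabs_cos (a b : R) : 0 < a ->
  \int[mu]_x (expR (- a * `|x|) * cos (b * x)) = 2 * a / (a ^+ 2 + b ^+ 2).
Proof.
move=> a0.
have icos : mu.-integrable setT (EFin \o (fun x => expR (- a * `|x|) * cos (b * x))).
  apply: integrable_bounded_mul; first exact: integrable_expabs.
    by apply: measurableT_comp; [exact: measurable_cos|exact: measurable_funM].
  by move=> x; exact: cos_max.
have := integral_expabs1Dcos b a0 => /(congr1 fine) /=.
rewrite -[LHS]/(\int[mu]_x (expR (- a * `|x|) * (1 + cos (b * x)))).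
under eq_Rintegral => x _ do rewrite mulrDr mulr1.
rewrite RintegralD//; last exact: integrable_expabs.
rewrite /(\int[mu]_x expR _) integral_expabs//=; exact: addrI.
Qed.

Lemma Rintegral_expabs_sin (a b : R) :
  \int[mu]_x (expR (- a * `|x|) * sin (b * x)) = 0.
Proof.
apply: Rintegral_odd => [|x]; last by rewrite normrN mulrN sinN mulrN.
apply: measurable_funM.
  by apply: continuous_measurable_fun; exact: continuous_expabs.
by apply: measurableT_comp; [exact: measurable_sin|exact: measurable_funM].
Qed.

Let cos_2pi_int (m : int) : cos (2 * pi * m%:~R) = 1 :> R.
Proof.
have H (n : nat) : cos (2 * pi * n%:R) = 1 :> R.
  rewrite (_ : 2 * pi * n%:R = 0 + (pi *+ 2) *+ n); last first.
    by rewrite add0r -[in RHS]mulr_natr -(mulr_natr pi 2); ring.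
  by rewrite (periodicn (@cosD2pi R)) cos0.
by case: m => n; rewrite ?NegzE ?mulrNz ?mulrN ?cosN -?pmulrn H.
Qed.

Let sin_2pi_int (m : int) : sin (2 * pi * m%:~R) = 0 :> R.
Proof. by apply: cos1sin0; rewrite cos_2pi_int normr1. Qed.

Lemma Rintegral_01_antideriv (f F : R -> R) : continuous f ->
  (forall x : R, is_derive x 1 F (f x)) ->
  \int[mu]_(y in `[0, 1]) f y = F 1 - F 0.
Proof.
move=> cf dF.
have cF (x : R) : {for x, continuous F}.
  by apply/differentiable_continuous/derivable1_diffP; have [] := dF x.
rewrite /Rintegral (@continuous_FTC2 _ _ F)//=.
- exact: continuous_subspaceT.
- split => [x _||]; first by have [] := dF x.
    exact/cvg_at_right_filter/cF.
  exact/cvg_at_left_filter/cF.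
- by move=> x _; rewrite derive1E; have d := dF x; rewrite derive_val.
Qed.

Lemma Rintegral_01_cos (m : int) :
  \int[mu]_(y in `[0, 1]) cos (2 * pi * m%:~R * y) = (m == 0)%:R.
Proof.
have [->|m0] := eqVneq m 0.
  under eq_Rintegral => y _ do rewrite mulr0z mulr0 mul0r cos0.
  by rewrite Rintegral_cst// mul1r /= lebesgue_measure_itv/= lte_fin ltr01 /= subr0.
have w0 : 2 * pi * m%:~R != 0 :> R.
  by rewrite mulf_neq0 ?intr_eq0// mulf_neq0// gt_eqF// pi_gt0.
have dF (x : R) : is_derive x 1
    (fun y => sin (2 * pi * m%:~R * y) / (2 * pi * m%:~R)) (cos (2 * pi * m%:~R * x)).
  apply: is_derive_eq; rewrite /GRing.scale /=.
  by move: w0; set w := 2 * pi * _ => w0; field.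
rewrite (Rintegral_01_antideriv _ dF); first by rewrite mulr1 sin_2pi_int mulr0 sin0 !mul0r subrr.
move=> x; apply: (@continuous_comp _ _ _ (fun x : R => 2 * pi * m%:~R * x) cos).
  exact: mulrl_continuous.
exact: continuous_cos.
Qed.

Lemma Rintegral_01_sin (m : int) :
  \int[mu]_(y in `[0, 1]) sin (2 * pi * m%:~R * y) = 0.
Proof.
have [->|m0] := eqVneq m 0.
  under eq_Rintegral => y _ do rewrite mulr0z mulr0 mul0r sin0.
  by rewrite Rintegral_cst// mul0r.
have w0 : 2 * pi * m%:~R != 0 :> R.
  by rewrite mulf_neq0 ?intr_eq0// mulf_neq0// gt_eqF// pi_gt0.
have dF (x : R) : is_derive x 1
    (fun y => - cos (2 * pi * m%:~R * y) / (2 * pi * m%:~R)) (sin (2 * pi * m%:~R * x)).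
  apply: is_derive_eq; rewrite /GRing.scale /=.
  by move: w0; set w := 2 * pi * _ => w0; field.
rewrite (Rintegral_01_antideriv _ dF); first by rewrite mulr1 cos_2pi_int mulr0 cos0 subrr.
move=> x; apply: (@continuous_comp _ _ _ (fun x : R => 2 * pi * m%:~R * x) sin).
  exact: mulrl_continuous.
exact: continuous_sin.
Qed.

End lebesgue_line.

(** * Weights and counting *)

Lemma measurable_inv_addsqr (R : realType) (c : R) : 0 < c ->
  measurable_fun [set: R] (fun x => (c + x ^+ 2)^-1).
Proof.
move=> c0; apply: continuous_measurable_fun => x; apply: cvgV.
  by rewrite gt_eqF// ltr_pwDl// sqr_ge0.
by apply: cvgD; [exact: cvg_cst|exact: exprn_continuous].
Qed.

Section even_mass.
Context (d : measure_display) (Y : measurableType d) (R : realType)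
  (m : {measure set Y -> \bar R}).

(* [int W e^(i phi) dm = K], with [K] real. *)
Definition even_mass (W phi : Y -> R) (K : R) :=
  \int[m]_y (W y * cos (phi y)) = K /\ \int[m]_y (W y * sin (phi y)) = 0.

(** The sine part of [cos (phi + c)] integrates to 0. Below, [c] collects the shifts by [pi / 2]
    that encode imaginary parts. *)
Lemma even_mass_shift (W phi : Y -> R) (K c : R) :
  m.-integrable setT (EFin \o W) -> measurable_fun setT phi ->
  even_mass W phi K -> \int[m]_y (W y * cos (phi y + c)) = K * cos c.
Proof.
move=> iW mphi [KE sE].
have ic : m.-integrable setT (EFin \o (fun y => W y * cos (phi y))).
  apply: integrable_bounded_mul => //; last by move=> x; exact: cos_max.
  by apply: measurableT_comp => //; exact: measurable_cos.
have isn : m.-integrable setT (EFin \o (fun y => W y * sin (phi y))).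
  apply: integrable_bounded_mul => //; last by move=> x; exact: sin_max.
  by apply: measurableT_comp => //; exact: measurable_sin.
under eq_Rintegral => y _ do rewrite cosD mulrBr !mulrA.
rewrite RintegralB//; last 2 first.
- by apply: (@eq_integrable _ _ _ m _ measurableT _ _ _
    (integrableZr measurableT (cos c) ic)) => y _.
- by apply: (@eq_integrable _ _ _ m _ measurableT _ _ _
    (integrableZr measurableT (sin c) isn)) => y _.
by rewrite !RintegralZr// KE sE mul0r subr0.
Qed.

End even_mass.

(** In the addition formulas every term other than the product of the two cosine integrals contains
    a vanishing sine integral. *)
Lemma even_mass_tensor (d1 d2 : measure_display) (Y1 : measurableType d1)
    (Y2 : measurableType d2) (R : realType)
    (m1 : {sigma_finite_measure set Y1 -> \bar R})
    (m2 : {sigma_finite_measure set Y2 -> \bar R})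
    (W1 phi1 : Y1 -> R) (W2 phi2 : Y2 -> R) (K1 K2 : R) :
  m1.-integrable setT (EFin \o W1) -> measurable_fun setT phi1 ->
  m2.-integrable setT (EFin \o W2) -> measurable_fun setT phi2 ->
  even_mass m1 W1 phi1 K1 -> even_mass m2 W2 phi2 K2 ->
  even_mass (prodm m1 m2) (fun z => W1 z.1 * W2 z.2)
    (fun z => phi1 z.1 + phi2 z.2) (K1 * K2).
Proof.
move=> iW1 mp1 iW2 mp2 [C1 S1] [C2 S2].
have ic1 : m1.-integrable setT (EFin \o (fun y => W1 y * cos (phi1 y))).
  apply: integrable_bounded_mul => //; last by move=> x; exact: cos_max.
  by apply: measurableT_comp => //; exact: measurable_cos.
have is1 : m1.-integrable setT (EFin \o (fun y => W1 y * sin (phi1 y))).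
  apply: integrable_bounded_mul => //; last by move=> x; exact: sin_max.
  by apply: measurableT_comp => //; exact: measurable_sin.
have ic2 : m2.-integrable setT (EFin \o (fun y => W2 y * cos (phi2 y))).
  apply: integrable_bounded_mul => //; last by move=> x; exact: cos_max.
  by apply: measurableT_comp => //; exact: measurable_cos.
have is2 : m2.-integrable setT (EFin \o (fun y => W2 y * sin (phi2 y))).
  apply: integrable_bounded_mul => //; last by move=> x; exact: sin_max.
  by apply: measurableT_comp => //; exact: measurable_sin.
split.
  transitivity (\int[prodm m1 m2]_z
    (((W1 z.1 * cos (phi1 z.1)) * (W2 z.2 * cos (phi2 z.2))) -
     ((W1 z.1 * sin (phi1 z.1)) * (W2 z.2 * sin (phi2 z.2))))).
    by apply: eq_Rintegral => z _; rewrite cosD; ring.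
  rewrite RintegralB//; last 2 first.
    exact: (integrable_tensor ic1 ic2).
    exact: (integrable_tensor is1 is2).
  by rewrite (Rintegral_tensor ic1 ic2) (Rintegral_tensor is1 is2) C1 C2 S1 S2 mul0r subr0.
transitivity (\int[prodm m1 m2]_z
  (((W1 z.1 * sin (phi1 z.1)) * (W2 z.2 * cos (phi2 z.2))) +
   ((W1 z.1 * cos (phi1 z.1)) * (W2 z.2 * sin (phi2 z.2))))).
  by apply: eq_Rintegral => z _; rewrite sinD; ring.
rewrite RintegralD//; last 2 first.
  exact: (integrable_tensor is1 ic2).
  exact: (integrable_tensor ic1 is2).
by rewrite (Rintegral_tensor is1 ic2) (Rintegral_tensor ic1 is2) C1 C2 S1 S2 mul0r mulr0 addr0.
Qed.

(** * Weights and their Fourier transforms *)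

Section weights.
Variable R : realType.
Notation mu := (@lebesgue_measure R).

(** This is the Fourier transform of [e^(- del |x|)] at angular frequency [s]; ordinary frequencies
    enter as [2 * pi * xi]. *)
Definition poisson (del s : R) := 2 * del / (del ^+ 2 + s ^+ 2).

Lemma poisson_ge0 del s : 0 < del -> 0 <= poisson del s.
Proof. by move=> d0; rewrite divr_ge0// ?addr_ge0 ?sqr_ge0// mulr_ge0// ltW. Qed.

Lemma poissonN del s : poisson del (- s) = poisson del s.
Proof. by rewrite /poisson sqrrN. Qed.

Lemma measurable_poisson del : 0 < del -> measurable_fun [set: R] (poisson del).
Proof.
move=> d0; apply: measurable_funM => //; apply: measurable_inv_addsqr.
exact: exprn_gt0.
Qed.

(** Rescaling to a Lorentzian makes [del] cancel. Mass 1 serves twice: Schur's constant is uniform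
    in [del], and the kernels form an approximate identity as [del] tends to 0. *)
Lemma integral_poisson del c : 0 < del ->
  (\int[mu]_s (poisson del (2 * pi * (c - s)))%:E = 1)%E.
Proof.
move=> d0; have d0' : del != 0 by rewrite gt_eqF.
have p0 : 0 < 2 * pi / del :> R by rewrite divr_gt0// mulr_gt0// pi_gt0.
have E (w s : R) : poisson del (w * s) = 2 / del * (1 + (w / del * s) ^+ 2)^-1.
  rewrite /poisson; field; rewrite d0' /= gt_eqF// ltr_pwDl ?sqr_ge0//.
  exact: exprn_gt0.
rewrite (ge0_integral_reflect (f := fun s => (poisson del (2 * pi * s))%:E) c)//; last 2 first.
- apply/measurable_EFinP; apply: measurableT_comp; first exact: measurable_poisson.
  exact: measurable_funM.
- by move=> x; rewrite lee_fin poisson_ge0.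
under eq_integral => s _ do rewrite E EFinM.
rewrite ge0_integralZl//.
- have F (p : R) : p != 0 -> 2 / del * (p / (2 * p / del)) = 1.
    by move=> ?; field; apply/andP.
  by rewrite integral_lorentz// -EFinM F// gt_eqF// pi_gt0.
- apply/measurable_EFinP; apply: (measurableT_comp (measurable_inv_addsqr ltr01)).
  exact: measurable_funM.
- by move=> x _; rewrite lee_fin invr_ge0 addr_ge0// sqr_ge0.
- by rewrite lee_fin divr_ge0// ltW.
Qed.

Definition wexp (del x : R) := expR (- del * `|x|).
Definition wper : R -> R := \1_`[0, 1].
Definition wsp del (p : R * R) := wexp del p.1 * wper p.2.
(** The rate in time is fixed to 1, as times are confined to [[0, 1]]; only the rate in [x] tends to
    0. *)
Definition wst del (p : R * (R * R)) := wexp 1 p.1 * wsp del p.2.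

Lemma wexp_gt0 del x : 0 < wexp del x. Proof. exact: expR_gt0. Qed.

Lemma wper_ge0 y : 0 <= wper y. Proof. by []. Qed.

Lemma wsp_ge0 del p : 0 <= wsp del p.
Proof. by rewrite mulr_ge0// ltW// wexp_gt0. Qed.

Lemma wst_ge0 del p : 0 <= wst del p.
Proof. by rewrite mulr_ge0 ?wsp_ge0// ltW// wexp_gt0. Qed.

Lemma integrable_wper : mu.-integrable setT (EFin \o wper).
Proof. exact: integrable_indic_itv. Qed.

Lemma integrable_wsp del : 0 < del -> (prodm mu mu).-integrable setT (EFin \o wsp del).
Proof.
move=> d0; exact: (integrable_tensor (integrable_expabs d0) integrable_wper).
Qed.

Lemma integrable_wst del : 0 < del ->
  (prodm mu (prodm mu mu)).-integrable setT (EFin \o wst del).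
Proof.
move=> d0.
exact: (integrable_tensor (integrable_expabs (@ltr01 R)) (integrable_wsp d0)).
Qed.

Lemma even_mass_wexp del b : 0 < del ->
  even_mass mu (wexp del) (fun x => b * x) (poisson del b).
Proof.
by move=> d0; split; [exact: Rintegral_expabs_cos|exact: Rintegral_expabs_sin].
Qed.

Lemma even_mass_wper (k : int) :
  even_mass mu wper (fun y => 2 * pi * k%:~R * y) (k == 0)%:R.
Proof.
have E (f : R -> R) : \int[mu]_y (wper y * f y) = \int[mu]_(y in `[0, 1]) f y.
  rewrite [RHS]Rintegral_mkcond; apply: eq_Rintegral => y _.
  by rewrite /wper patchE indicE; case: ifPn => _; rewrite ?mul1r ?mul0r.
by split; rewrite E; [exact: Rintegral_01_cos|exact: Rintegral_01_sin].
Qed.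

Lemma even_mass_wsp del b (k : int) : 0 < del ->
  even_mass (prodm mu mu) (wsp del) (fun p => b * p.1 + 2 * pi * k%:~R * p.2)
    (poisson del b * (k == 0)%:R).
Proof.
move=> d0; apply: even_mass_tensor.
- exact: integrable_expabs.
- exact: measurable_funM.
- exact: integrable_wper.
- exact: measurable_funM.
- exact: even_mass_wexp.
- exact: even_mass_wper.
Qed.

Lemma even_mass_wst del a b (k : int) : 0 < del ->
  even_mass (prodm mu (prodm mu mu)) (wst del)
    (fun p => a * p.1 + (b * p.2.1 + 2 * pi * k%:~R * p.2.2))
    (poisson 1 a * (poisson del b * (k == 0)%:R)).
Proof.
move=> d0; have ma : measurable_fun [set: R] (fun t => a * t) by exact: measurable_funM.
have mb : measurable_fun setT (fun q : R * R => b * q.1 + 2 * pi * k%:~R * q.2).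
  by apply: measurable_funD; apply: measurable_funM.
exact: (even_mass_tensor (integrable_expabs ltr01) ma (integrable_wsp d0) mb
  (even_mass_wexp a ltr01) (even_mass_wsp b k d0)).
Qed.

End weights.

(** * Harmonic sums, and resonance estimates for parabola and hyperbola *)

Section counting.
Variable R : realType.
Notation mu := (@lebesgue_measure R).

Definition harmonic_sum (n : nat) : R := \sum_(j < n) (j.+1%:R)^-1.

(* Removing the endpoint of the window farthest from [al] costs at most [2/(n+1)]. *)
Lemma sum_inv_dist_le (n : nat) (al : R) :
  \sum_(j < n) (1 + `|j%:R - al|)^-1 <= 2 * harmonic_sum n.
Proof.
elim: n al => [al|n IH al]; first by rewrite /harmonic_sum !big_ord0 mulr0.
have n0 : 0 <= n%:R :> R by [].
have far (x : R) : n%:R / 2 <= `|x| -> (1 + `|x|)^-1 <= 2 / n.+1%:R.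
  have x0 : 0 < 1 + `|x| by rewrite ltr_pwDl.
  move=> h; rewrite -[leRHS]invf_div lef_pV2 ?posrE//.
  by rewrite -natr1; lra.
have -> : harmonic_sum n.+1 = harmonic_sum n + n.+1%:R^-1.
  by rewrite /harmonic_sum big_ord_recr.
rewrite mulrDr; have [al2|al2] := leP al (n%:R / 2).
  rewrite big_ord_recr /=; apply: lerD; first exact: IH.
  by apply: far; rewrite ger0_norm; lra.
rewrite big_ord_recl addrC /=; apply: lerD.
  apply: le_trans (IH (al - 1)).
  apply: ler_sum => j _; rewrite /bump /= add1n.
  by rewrite (_ : j.+1%:R - al = j%:R - (al - 1))// -natr1; ring.
by apply: far; rewrite ler0_norm; lra.
Qed.

Lemma harmonic_sum_ge0 n : 0 <= harmonic_sum n.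
Proof. by apply: sumr_ge0 => j _; rewrite invr_ge0. Qed.

Lemma harmonic_sum_ln (n : nat) : harmonic_sum n.+1 <= 1 + ln n.+1%:R.
Proof.
elim: n => [|n IH]; first by rewrite /harmonic_sum big_ord1 ln1 invr1 addr0.
rewrite /harmonic_sum big_ord_recr /=.
have h : n.+2%:R^-1 <= ln n.+2%:R - ln n.+1%:R :> R.
  (* [ln (1 + x) <= x] at [x = - 1 / (n + 2)] bounds the new term by a difference of consecutive
     logarithms. *)
  have := @le_ln1Dx R (- n.+2%:R^-1).
  have n2 : 0 < n.+2%:R :> R by [].
  rewrite (_ : 1 + - n.+2%:R^-1 = n.+1%:R / n.+2%:R); last first.
    have -> : n.+1%:R = n.+2%:R - 1 :> R by rewrite -(@natr1 R n.+1) addrK.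
    by rewrite mulrBl divff ?gt_eqF// mul1r.
  rewrite ln_div ?posrE// => H; rewrite -subr_ge0.
  have : -1 < - n.+2%:R^-1 :> R by rewrite ltrN2 invf_lt1// ltr1n.
  move=> /H; move: (ln n.+1%:R) (ln n.+2%:R) (n.+2%:R^-1) => x y z; lra.
move: h IH; rewrite /harmonic_sum; move: (\sum_(_ < _) _) => a.
by move: (ln n.+1%:R) (ln n.+2%:R) (n.+2%:R^-1) => x y z; lra.
Qed.

(** Write [a^2 - u^2 = (a - u) (a + u)] with [u^2 = |m|]. The larger factor is at least [u] in
    modulus, so near [u] and [- u] the function is dominated by a Lorentzian of width
    [(1 + |m|)^(-1/2)]. The sign of [a] decides which of the two is used. *)
Lemma lorentz_parabola (a m : R) : (1 + (a ^+ 2 - m) ^+ 2)^-1 <=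
  2 * (1 + (Num.sqrt (1 + `|m|) * (Num.sqrt `|m| - a)) ^+ 2)^-1 +
  2 * (1 + (Num.sqrt (1 + `|m|) * (- Num.sqrt `|m| - a)) ^+ 2)^-1.
Proof.
set u := Num.sqrt `|m|; set v := Num.sqrt (1 + `|m|).
have u0 : 0 <= u by exact: sqrtr_ge0.
have uE : u ^+ 2 = `|m| by rewrite sqr_sqrtr.
have vE : v ^+ 2 = 1 + u ^+ 2 by rewrite uE sqr_sqrtr// addr_ge0.
have pos (x : R) : 0 < 1 + x ^+ 2 by rewrite ltr_pwDl// sqr_ge0.
have pos' (x : R) : 0 <= 2 * (1 + x ^+ 2)^-1 by rewrite mulr_ge0// invr_ge0 ltW.
(* For negative [m], replacing [m] by [|m|] brings it closer to [a^2]. *)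
have m1 : (a ^+ 2 - u ^+ 2) ^+ 2 <= (a ^+ 2 - m) ^+ 2.
  have := sqr_ge0 a; rewrite uE; have [m0|m0] := leP 0 m.
    by rewrite ger0_norm.
  by rewrite ltr0_norm// => a0; nra.
(* Here [v^2 x^2 = x^2 + u^2 x^2]; the second term is at most [x^2 y^2], the first at most
   [1 + x^4 <= 1 + x^2 y^2]. *)
have key (x y : R) : 0 <= x -> x <= y -> u <= y ->
    1 + v ^+ 2 * x ^+ 2 <= 2 * (1 + (x * y) ^+ 2).
  move=> x0 xy uy; rewrite vE exprMn.
  have h1 : u ^+ 2 <= y ^+ 2 by rewrite ler_sqr ?nnegrE// (le_trans u0).
  have h2 : x ^+ 2 <= y ^+ 2 by rewrite ler_sqr ?nnegrE// (le_trans x0).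
  have h3 := sqr_ge0 x; have h4 : 0 <= (x ^+ 2 - 1) ^+ 2 by exact: sqr_ge0.
  nra.
have fin (x y : R) : 1 + v ^+ 2 * x ^+ 2 <= 2 * (1 + (x * y) ^+ 2) ->
    (x * y) ^+ 2 = (a ^+ 2 - u ^+ 2) ^+ 2 ->
    (1 + (a ^+ 2 - m) ^+ 2)^-1 <= 2 * (1 + (v * x) ^+ 2)^-1.
  move=> h e; rewrite -[leRHS]invf_div lef_pV2 ?posrE ?divr_gt0//.
  by rewrite ler_pdivrMr// exprMn; rewrite e in h; lra.
have [a0|a0] := leP 0 a.
  apply: ler_wpDr; first exact: pos'.
  rewrite (_ : (v * (u - a)) ^+ 2 = (v * `|u - a|) ^+ 2); last first.
    by rewrite !exprMn real_normK ?num_real.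
  apply: (fin _ (u + a)).
    apply: key => //; last lra.
    by rewrite ler_norml; lra.
  by rewrite exprMn real_normK ?num_real//; ring.
apply: ler_wpDl; first exact: pos'.
rewrite (_ : (v * (- u - a)) ^+ 2 = (v * `|u + a|) ^+ 2); last first.
  by rewrite !exprMn real_normK ?num_real//; ring.
apply: (fin _ (u - a)).
  apply: key => //; last lra.
  by rewrite ler_norml; lra.
by rewrite exprMn real_normK ?num_real//; ring.
Qed.

(** Each of the two Lorentzians has height 2 and integral [2 * pi / v]. *)
Lemma integral_lorentz_parabola (m : R) :
  (\int[mu]_a ((1 + (a ^+ 2 - m) ^+ 2)^-1)%:E <= (4 * pi / Num.sqrt (1 + `|m|))%:E)%E.
Proof.
set u := Num.sqrt `|m|; set v := Num.sqrt (1 + `|m|).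
have v0 : 0 < v by rewrite sqrtr_gt0 ltr_pwDl.
pose L c (a : R) := 2 * (1 + (v * (c - a)) ^+ 2)^-1.
have mL0 : measurable_fun [set: R] (fun a => 2 * (1 + (v * a) ^+ 2)^-1).
  apply: measurable_funM => //; apply: (measurableT_comp (measurable_inv_addsqr ltr01)).
  exact: measurable_funM.
have mL c : measurable_fun [set: R] (L c).
  by apply: (measurableT_comp mL0); exact: measurable_funB.
have mLE c : measurable_fun [set: R] (fun a => (L c a)%:E) by exact/measurable_EFinP.
have L0 c a : 0 <= L c a by rewrite mulr_ge0// invr_ge0 addr_ge0// sqr_ge0.
have iL c : (\int[mu]_a (L c a)%:E = (2 * (pi / v))%:E)%E.
  rewrite (ge0_integral_reflect (f := fun a => (2 * (1 + (v * a) ^+ 2)^-1)%:E) c)//.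
  - rewrite EFinM -integral_lorentz// -ge0_integralZl//.
    + apply/measurable_EFinP; apply: (measurableT_comp (measurable_inv_addsqr ltr01)).
      exact: measurable_funM.
    + by move=> x _; rewrite lee_fin invr_ge0 addr_ge0// sqr_ge0.
  - exact/measurable_EFinP.
  - by move=> x; rewrite lee_fin mulr_ge0// invr_ge0 addr_ge0// sqr_ge0.
rewrite (_ : (4 * pi / v)%:E = (\int[mu]_a ((L u a)%:E + (L (- u) a)%:E))%E); last first.
  rewrite ge0_integralD//; try (by move=> x _; rewrite lee_fin);
    try exact: mLE.
  by rewrite !iL -EFinD; congr EFin; field; rewrite gt_eqF.
apply: ge0_le_integral_nomeas => a _.
  by rewrite lee_fin invr_ge0 addr_ge0// sqr_ge0.
by rewrite -EFinD lee_fin; exact: lorentz_parabola.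
Qed.

(** Put [e = sqrt |tau|]. For [tau < 0], [tau + h^2 = (h - e) (h + e)] is in modulus at least the
    square of the smaller factor; for [tau >= 0], [e^2 + h^2] dominates the same square. The inverse
    square root thus becomes an inverse distance, whose sum over unit-spaced [h] is logarithmic. *)
Lemma inv_sqrt_hyperbola (h tau : R) :
  (Num.sqrt (1 + `|tau + h ^+ 2|))^-1 <=
  2 * (1 + `|h - Num.sqrt `|tau| |)^-1 + 2 * (1 + `|h + Num.sqrt `|tau| |)^-1.
Proof.
set e := Num.sqrt `|tau|.
have e0 : 0 <= e by exact: sqrtr_ge0.
have eE : e ^+ 2 = `|tau| by rewrite sqr_sqrtr.
have pos (x : R) : 0 < 1 + `|x| by rewrite ltr_pwDl.
have pos' (x : R) : 0 <= 2 * (1 + `|x|)^-1 by rewrite mulr_ge0// invr_ge0 ltW.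
have fin (x : R) : x ^+ 2 <= `|tau + h ^+ 2| ->
    (Num.sqrt (1 + `|tau + h ^+ 2|))^-1 <= 2 * (1 + `|x|)^-1.
  move=> hx; rewrite -[leRHS]invf_div lef_pV2 ?posrE ?divr_gt0// ?sqrtr_gt0//.
  rewrite -(@ger0_norm _ ((1 + `|x|) / 2)) ?divr_ge0 ?(ltW (pos _))//.
  rewrite -sqrtr_sqr ler_wsqrtr//.
  have := real_normK (num_real x); have := sqr_ge0 (`|x| - 1).
  by nra.
have [h0|h0] := leP 0 h.
  apply: ler_wpDr => //; apply: fin.
  have [t0|t0] := leP 0 tau.
    by rewrite ger0_norm ?addr_ge0 ?sqr_ge0//; move: eE; rewrite ger0_norm//; nra.
  rewrite (_ : tau + h ^+ 2 = (h - e) * (h + e)); last first.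
    by move: eE; rewrite ltr0_norm//; lra.
  rewrite normrM -[leLHS]real_normK ?num_real// expr2 ler_wpM2l//.
  by rewrite (@ger0_norm _ (h + e)) ?addr_ge0// ler_norml; lra.
apply: ler_wpDl => //; apply: fin.
have [t0|t0] := leP 0 tau.
  by rewrite ger0_norm ?addr_ge0 ?sqr_ge0//; move: eE; rewrite ger0_norm//; nra.
rewrite (_ : tau + h ^+ 2 = (h + e) * (h - e)); last first.
  by move: eE; rewrite ltr0_norm//; lra.
rewrite normrM -[leLHS]real_normK ?num_real// expr2 ler_wpM2l//.
by rewrite (@ler0_norm _ (h - e)) ?ler_norml; lra.
Qed.

End counting.

(** * The resonance kernel *)

Section strichartz_kernel.
Variable R : realType.
Notation mu := (@lebesgue_measure R).

(** In the variables [x] and [s = z.1 + z.2], each slice integral is at most [A], and averaging over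
    [s] against a density of mass 1 keeps the bound. *)
Lemma integral_convolution_le (P : R -> R) (Phi : R * R -> R) (s0 A : R) :
  measurable_fun setT P -> (forall s, 0 <= P s) ->
  (\int[mu]_s (P (s0 - s))%:E = 1)%E ->
  measurable_fun setT Phi -> (forall z, 0 <= Phi z) ->
  (forall s, (\int[mu]_x (Phi (x, s - x))%:E <= A%:E)%E) ->
  (\int[prodm mu mu]_z (P (s0 - (z.1 + z.2)) * Phi z)%:E <= A%:E)%E.
Proof.
move=> mP P0 iP mPhi Phi0 HA.
have mPs : measurable_fun setT (fun s : R => P (s0 - s)).
  by apply: (measurableT_comp mP); exact: measurable_funB.
have mPhi' : measurable_fun setT (fun z : R * R => Phi (z.1, z.2 - z.1)).
  apply: (measurableT_comp mPhi (g := fun z : R * R => (z.1, z.2 - z.1))).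
  by apply: measurable_fun_pair => //; exact: measurable_funB.
have mF : measurable_fun setT (fun z : R * R => (P (s0 - (z.1 + z.2)) * Phi z)%:E).
  apply/measurable_EFinP; apply: measurable_funM => //.
  by apply: (measurableT_comp mPs); exact: measurable_funD.
have mF' : measurable_fun setT
    (fun z : R * R => (P (s0 - z.2) * Phi (z.1, z.2 - z.1))%:E).
  apply/measurable_EFinP; apply: measurable_funM => //.
  exact: (measurableT_comp mPs).
rewrite (ge0_integral12_prod mu mu mF) /=; last first.
  by move=> z; rewrite lee_fin mulr_ge0.
rewrite (_ : (\int[mu]_x _)%E =
  (\int[mu]_x \int[mu]_s (P (s0 - s) * Phi (x, s - x))%:E)%E); last first.
  apply: eq_integral => x _.
  rewrite -(ge0_integral_shift (f := fun s => (P (s0 - s) * Phi (x, s - x))%:E) x).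
  - by apply: eq_integral => y _; rewrite addrAC subrr add0r.
  - exact: (measurableT_comp mF' (pair1_measurable x)).
  - by move=> s; rewrite lee_fin mulr_ge0.
rewrite -(ge0_integral12_prod mu mu mF') /=; last first.
  by move=> z; rewrite lee_fin mulr_ge0.
rewrite (ge0_integral21_prod mu mu mF') /=; last first.
  by move=> z; rewrite lee_fin mulr_ge0.
rewrite -[X in (_ <= X)%E]mule1 -iP -ge0_integralZl//; last 3 first.
- exact/measurable_EFinP.
- by move=> s _; rewrite lee_fin.
- apply: le_trans (HA 0); apply: integral_ge0 => x _; rewrite lee_fin//.
apply: ge0_le_integral_nomeas => s _.
  by apply: integral_ge0 => x _; rewrite lee_fin mulr_ge0.
under eq_integral do rewrite EFinM.
rewrite ge0_integralZl//; last 3 first.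
- apply/measurable_EFinP; exact: (measurableT_comp mPhi' (pair2_measurable s)).
- by move=> x _; rewrite lee_fin.
- by rewrite lee_fin.
by rewrite muleC; apply: lee_wpmul2r; rewrite ?lee_fin.
Qed.

(** As [x^2 + (s - x)^2 = 2 (x - s/2)^2 + s^2 / 2], the argument is a multiple of
    [a^2 - (tau + h^2)] with [a = x - s/2]. The parabola estimate integrates over [a], the hyperbola
    estimate then isolates [h]; [16 pi] is [2 * 4 pi * 2]. *)
Lemma integral_poisson_circle (t0 s h : R) :
  (\int[mu]_x (poisson 1 (4 * pi ^+ 2 * (t0 - x ^+ 2 - (s - x) ^+ 2 + 2 * h ^+ 2)))%:E <=
   (16 * pi * ((1 + `|h - Num.sqrt `|(t0 - s ^+ 2 / 2) / 2| |)^-1 +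
     (1 + `|h + Num.sqrt `|(t0 - s ^+ 2 / 2) / 2| |)^-1))%:E)%E.
Proof.
set tau := (t0 - s ^+ 2 / 2) / 2.
pose f (a : R) := 2 * (1 + (a ^+ 2 - (tau + h ^+ 2)) ^+ 2)^-1.
have mf : measurable_fun [set: R] (fun a => (1 + (a ^+ 2 - (tau + h ^+ 2)) ^+ 2)^-1).
  apply: (measurableT_comp (measurable_inv_addsqr ltr01)).
  by apply: measurable_funB => //; exact: measurable_funX.
have f0 a : 0 <= f a by rewrite mulr_ge0// invr_ge0 addr_ge0// sqr_ge0.
have pi2 : 1 <= 8 * pi ^+ 2 :> R.
  have := pi_ge2 R; have := pi_gt0 R; move: (@pi R) => p; nra.
apply: (@le_trans _ _ (\int[mu]_x (f (- (s / 2) + x))%:E)%E).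
  apply: ge0_le_integral_nomeas => x _; first by rewrite lee_fin poisson_ge0.
  rewrite lee_fin /poisson /f mulr1 expr1n ler_wpM2l// lef_pV2 ?posrE; last 2 first.
  - by rewrite ltr_pwDl// sqr_ge0.
  - by rewrite ltr_pwDl// sqr_ge0.
  rewrite lerD2l (_ : t0 - x ^+ 2 - (s - x) ^+ 2 + 2 * h ^+ 2 =
    - 2 * ((- (s / 2) + x) ^+ 2 - (tau + h ^+ 2))); last by rewrite /tau; field.
  move: (_ - (tau + _)) => v.
  rewrite (_ : 4 * _ * _ = - (8 * pi ^+ 2) * v); last by ring.
  rewrite exprMn sqrrN ler_peMl ?sqr_ge0//.
  by rewrite expr2; move: pi2; move: (8 * _) => q; nra.
rewrite (ge0_integral_shift (f := fun a => (f a)%:E)); last 2 first.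
- by apply/measurable_EFinP; exact: measurable_funM.
- by move=> x; rewrite lee_fin.
under eq_integral do rewrite /f EFinM.
rewrite ge0_integralZl//; last 2 first.
- exact/measurable_EFinP.
- by move=> x _; rewrite lee_fin invr_ge0 addr_ge0// sqr_ge0.
apply: (@le_trans _ _ (2%:E * (4 * pi / Num.sqrt (1 + `|tau + h ^+ 2|))%:E)%E).
  by apply: lee_wpmul2l; rewrite ?lee_fin//; exact: integral_lorentz_parabola.
rewrite -EFinM lee_fin.
have := inv_sqrt_hyperbola h tau; have := pi_gt0 R.
move: (_^-1) (_^-1) (_^-1) (@pi R) => x y z p p0 h1; nra.
Qed.

Variables (n K : nat).

(** The frequencies run from [-K] to [n - 1 - K]; in the final application [n = 2 K + 1], which is
    the symmetric window. *)
Definition kk (j : 'I_n) : int := (j : nat)%:Z - K%:Z.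

Lemma kk_inj : injective kk.
Proof. by move=> i j /addIr [] /ord_inj. Qed.

Lemma sum_kk_le (X : int -> R) (a : int) : (forall b, 0 <= X b) ->
  \sum_(j < n) X (kk j) * (a - kk j == 0)%:R <= X a.
Proof.
move=> X0; have [[j aj]|aj] := pselect (exists j, a = kk j).
  rewrite (bigD1 j)//= big1 => [|i ij]; last first.
    rewrite aj subr_eq0 (inj_eq kk_inj) eq_sym (negbTE ij) mulr0//.
  by rewrite addr0 -aj subrr eqxx mulr1.
rewrite big1// => i _; rewrite subr_eq0; case: eqP => [ai|]; last by rewrite mulr0.
by exfalso; apply: aj; exists i.
Qed.

Let I := ('I_n * bool)%type.

(* The flag [i.2] marks the imaginary part of the data: multiplication by the
   imaginary unit is a phase shift by [pi / 2], so that all amplitudes are real. *)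
Definition thst (i : I) (p : R * (R * R)) (xi : R) : R :=
  sphase p.1 p.2.1 p.2.2 xi (kk i.1) + (if i.2 then pi / 2 else 0).

Lemma measurable_thst i :
  measurable_fun setT (fun q : (R * (R * R)) * R => thst i q.1 q.2).
Proof.
have m1 : measurable_fun setT (fun q : (R * (R * R)) * R => q.1.1).
  exact: measurableT_comp.
have m2 : measurable_fun setT (fun q : (R * (R * R)) * R => q.1.2.1).
  by do 2 apply: measurableT_comp => //.
have m3 : measurable_fun setT (fun q : (R * (R * R)) * R => q.1.2.2).
  by do 2 apply: measurableT_comp => //.
have m4 : measurable_fun setT (fun q : (R * (R * R)) * R => q.2).
  exact: measurable_snd.
rewrite /thst; apply: measurable_funD; last exact: measurable_cst.
rewrite /sphase; apply: measurable_funB.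
  apply: measurable_funM => //; apply: measurable_funD; first exact: measurable_funM.
  exact: measurable_funM.
apply: measurable_funM; first exact: measurable_funM.
by apply: measurable_funB => //; exact: measurable_funX.
Qed.

Definition kdiff (i j : I * I) : int := kk i.1.1 + kk i.2.1 - kk j.1.1 - kk j.2.1.

(** Up to the factor [- 4 pi^2], this is the coefficient of [t] in the difference of the phases of
    the pairs [i] and [j]; [kdiff] plays this role for [y]. *)
Definition resonance (i j : I * I) (z : (R * R) * (R * R)) : R :=
  (z.1.1 ^+ 2 + z.1.2 ^+ 2 - z.2.1 ^+ 2 - z.2.2 ^+ 2) -
  ((kk i.1.1)%:~R ^+ 2 + (kk i.2.1)%:~R ^+ 2 - (kk j.1.1)%:~R ^+ 2 - (kk j.2.1)%:~R ^+ 2).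

Definition kern (del : R) (i j : I * I) (z : (R * R) * (R * R)) : R :=
  poisson 1 (- (4 * pi ^+ 2) * resonance i j z) *
  (poisson del (2 * pi * (z.1.1 + z.1.2 - (z.2.1 + z.2.2))) * (kdiff i j == 0)%:R).

Lemma gram_kernel_le (del : R) i j z : 0 < del ->
  `|gram_kernel (prodm mu (prodm mu mu)) (wst del) (phase2 thst) i j z| <= kern del i j z.
Proof.
move=> d0; rewrite /gram_kernel.
pose c (b : bool) : R := if b then pi / 2 else 0.
(* The flags only add a constant phase, which factors out as [cos c0], of modulus at most 1. *)
pose c0 := c i.1.2 + c i.2.2 - c j.1.2 - c j.2.2.
under eq_Rintegral => p _.
  rewrite (_ : phase2 thst i p z.1 - phase2 thst j p z.2 =
    (- (4 * pi ^+ 2) * resonance i j z * p.1 +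
     (2 * pi * (z.1.1 + z.1.2 - (z.2.1 + z.2.2)) * p.2.1 +
      2 * pi * (kdiff i j)%:~R * p.2.2)) + c0); last first.
    rewrite /phase2 /thst /sphase /resonance /kdiff /c0 -!/(c _) !(rmorphB, rmorphD) /=.
    move: (c _) (c _) (c _) (c _) => c1 c2 c3 c4.
    by move: (@pi R) => q; ring.
  over.
rewrite (even_mass_shift (K := kern del i j z)).
- have K0 : 0 <= kern del i j z.
    by rewrite /kern mulr_ge0 ?poisson_ge0// mulr_ge0// poisson_ge0.
  by rewrite normrM (ger0_norm K0) ler_piMr// cos_max.
- exact: integrable_wst.
- apply: measurable_funD; first exact: measurable_funM.
  by apply: measurable_funD; apply: measurable_funM => //; apply: measurableT_comp.
- exact: even_mass_wst.
Qed.

Lemma kern_ge0 (del : R) i j z : 0 < del -> 0 <= kern del i j z.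
Proof. by move=> d0; rewrite mulr_ge0 ?poisson_ge0// mulr_ge0// poisson_ge0. Qed.

Lemma measurable_kern (del : R) i j : 0 < del -> measurable_fun setT (kern del i j).
Proof.
move=> d0.
have m1 : measurable_fun setT (fun z : (R * R) * (R * R) => z.1.1).
  exact: measurableT_comp.
have m2 : measurable_fun setT (fun z : (R * R) * (R * R) => z.1.2).
  exact: measurableT_comp.
have m3 : measurable_fun setT (fun z : (R * R) * (R * R) => z.2.1).
  exact: measurableT_comp.
have m4 : measurable_fun setT (fun z : (R * R) * (R * R) => z.2.2).
  exact: measurableT_comp.
apply: measurable_funM.
  apply: (measurableT_comp (measurable_poisson ltr01)).
  apply: measurable_funM; first exact: measurable_cst.
  apply: measurable_funB; last exact: measurable_cst.
  apply: measurable_funB; last exact: measurable_funX.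
  apply: measurable_funB; last exact: measurable_funX.
  by apply: measurable_funD; exact: measurable_funX.
apply: measurable_funM; last exact: measurable_cst.
apply: (measurableT_comp (measurable_poisson d0)).
apply: measurable_funM; first exact: measurable_cst.
by apply: measurable_funB; exact: measurable_funD.
Qed.

(** Poisson kernels are even. The symmetry turns the column sums of Schur's test into row sums. *)
Lemma kern_sym (del : R) i j z1 z2 : kern del i j (z1, z2) = kern del j i (z2, z1).
Proof.
rewrite /kern /=; congr (_ * (_ * _)).
- by rewrite -poissonN; congr poisson; rewrite /resonance /=; ring.
- by rewrite -poissonN; congr poisson; ring.
- by rewrite -oppr_eq0 /kdiff; congr ((_ == _)%:R); ring.
Qed.

(** Once [a] is chosen, the delta forces the other integer frequency to be [l - a], so a single sum
    remains; 4 counts the flags. Since [a^2 + (l - a)^2 = 2 (a - l/2)^2 + l^2 / 2], the last term is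
    absorbed in [t0]. *)
Lemma sum_kern_le (del : R) (i : I * I) (x1 x2 : R) (z : R * R) (l : int) (t0 : R) : 0 < del ->
  l = kk i.1.1 + kk i.2.1 ->
  t0 = x1 ^+ 2 + x2 ^+ 2 - (kk i.1.1)%:~R ^+ 2 - (kk i.2.1)%:~R ^+ 2
    + l%:~R ^+ 2 / 2 ->
  \sum_j kern del i j ((x1, x2), z) <=
  poisson del (2 * pi * (x1 + x2 - (z.1 + z.2))) *
  (4 * \sum_(j < n) poisson 1 (4 * pi ^+ 2 *
     (t0 - z.1 ^+ 2 - z.2 ^+ 2 + 2 * ((kk j)%:~R - l%:~R / 2) ^+ 2))).
Proof.
move=> d0 lE tE.
pose X (a b : int) : R := poisson 1 (- (4 * pi ^+ 2) *
  ((x1 ^+ 2 + x2 ^+ 2 - z.1 ^+ 2 - z.2 ^+ 2) -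
   ((kk i.1.1)%:~R ^+ 2 + (kk i.2.1)%:~R ^+ 2 - a%:~R ^+ 2 - b%:~R ^+ 2))).
pose P := poisson del (2 * pi * (x1 + x2 - (z.1 + z.2))).
have P0 : 0 <= P by exact: poisson_ge0.
rewrite (_ : \sum_j _ = P * (4 *
    \sum_(a < n) \sum_(b < n) X (kk a) (kk b) * (l - kk a - kk b == 0)%:R)); last first.
  rewrite -(pair_big xpredT xpredT (fun a b => kern del i (a, b) ((x1, x2), z))) /=.
  rewrite -(pair_big xpredT xpredT (fun j3 c3 =>
    \sum_b kern del i ((j3, c3), b) ((x1, x2), z))) /= !mulr_sumr.
  apply: eq_bigr => a _; rewrite big_bool /= !mulr_sumr.
  rewrite -!(pair_big xpredT xpredT (fun j4 c4 =>
    kern del i ((a, _), (j4, c4)) ((x1, x2), z))) /= -big_split /=.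
  apply: eq_bigr => b _; rewrite !big_bool /kern /resonance /kdiff /=.
  rewrite -/(X (kk a) (kk b)) -/P -lE.
  by move: (X _ _) (_%:R : R) => x y; ring.
rewrite ler_wpM2l// ler_wpM2l//; apply: ler_sum => a _.
apply: (le_trans (sum_kk_le (X := X (kk a)) (l - kk a) _)).
  by move=> b; exact: poisson_ge0.
rewrite /X -poissonN le_eqVlt; apply/orP; left; apply/eqP; congr poisson.
by rewrite tE rmorphB /=; move: (@pi R) => q; field.
Qed.

(** The constant is [4 * 16 pi * 4]: the flags, the circle estimate, and two sums each bounded by
    twice the harmonic sum. *)
Lemma schur_kern (del : R) (i : I * I) (z1 : R * R) : 0 < del ->
  (\sum_j \int[prodm mu mu]_z2 (kern del i j (z1, z2))%:E <=
   (256 * pi * harmonic_sum R n)%:E)%E.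
Proof.
case: z1 => x1 x2 d0.
have mk j : measurable_fun setT (fun z2 => (kern del i j ((x1, x2), z2))%:E).
  apply/measurable_EFinP.
  exact: (measurableT_comp (measurable_kern i j d0) (pair1_measurable (x1, x2))).
rewrite -ge0_integral_sum//; last by move=> j z _; rewrite lee_fin kern_ge0.
set l : int := kk i.1.1 + kk i.2.1.
set t0 : R := x1 ^+ 2 + x2 ^+ 2 - (kk i.1.1)%:~R ^+ 2 - (kk i.2.1)%:~R ^+ 2
    + l%:~R ^+ 2 / 2.
pose h (j : 'I_n) : R := (kk j)%:~R - l%:~R / 2.
pose phi (j : 'I_n) (z : R * R) : R := poisson 1 (4 * pi ^+ 2 *
     (t0 - z.1 ^+ 2 - z.2 ^+ 2 + 2 * (h j) ^+ 2)).
pose Phi (z : R * R) : R := 4 * \sum_j phi j z.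
have phi0 j z : 0 <= phi j z by exact: poisson_ge0.
have mphi j : measurable_fun setT (phi j).
  apply: (measurableT_comp (measurable_poisson ltr01)).
  apply: measurable_funM; first exact: measurable_cst.
  apply: measurable_funD; last exact: measurable_cst.
  apply: measurable_funB; last exact: measurable_funX.
  apply: measurable_funB; first exact: measurable_cst.
  exact: measurable_funX.
have mPhi : measurable_fun setT Phi.
  apply: measurable_funM; first exact: measurable_cst.
  exact: measurable_sum.
pose PF (z : R * R) := poisson del (2 * pi * (x1 + x2 - (z.1 + z.2))) * Phi z.
apply: (@le_trans _ _ (\int[prodm mu mu]_z (PF z)%:E)%E).
  apply: ge0_le_integral_nomeas => z _.
    by apply: sume_ge0 => j _; rewrite lee_fin kern_ge0.
  by rewrite sumEFin lee_fin; exact: sum_kern_le.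
apply: (integral_convolution_le (P := fun s => poisson del (2 * pi * s))) => //.
- apply: (measurableT_comp (measurable_poisson d0)).
  exact: measurable_funM.
- by move=> s; exact: poisson_ge0.
- exact: integral_poisson.
- by move=> z; rewrite mulr_ge0// sumr_ge0.
move=> s.
under eq_integral => x _ do rewrite /Phi EFinM -sumEFin.
have mphis j : measurable_fun setT (fun x : R => (phi j (x, s - x))%:E).
  apply/measurable_EFinP; apply: (measurableT_comp (mphi j) (g := fun x : R => (x, s - x))).
  by apply: measurable_fun_pair => //; exact: measurable_funB.
rewrite ge0_integralZl//; last 2 first.
- rewrite (_ : (fun x => _) = EFin \o (fun x : R => \sum_j phi j (x, s - x))).
    apply/measurable_EFinP; apply: measurable_sum => j.
    by apply/measurable_EFinP; exact: mphis.
  by apply/funext => x; rewrite /= sumEFin.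
- by move=> x _; apply: sume_ge0 => j _; rewrite lee_fin.
rewrite ge0_integral_sum//; last by move=> j x _; rewrite lee_fin.
set e := Num.sqrt `|(t0 - s ^+ 2 / 2) / 2|.
apply: (@le_trans _ _ (4%:E * (\sum_j (16 * pi * ((1 + `|h j - e|)^-1 +
     (1 + `|h j + e|)^-1))%:E))%E).
  apply: lee_wpmul2l; first by rewrite lee_fin.
  by apply: lee_sum => j _; exact: integral_poisson_circle.
rewrite sumEFin -EFinM lee_fin -mulr_sumr big_split /=.
(* Up to a translation by [K + l/2 + c] these are distances to consecutive naturals, and the window
   estimate is uniform in the center. *)
have S (c : R) : \sum_(j < n) (1 + `|h j - c|)^-1 <= 2 * harmonic_sum R n.
  apply: le_trans (sum_inv_dist_le n (K%:R + l%:~R / 2 + c)).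
  apply: ler_sum => j _; rewrite (_ : h j - c = j%:R - (K%:R + l%:~R / 2 + c))//.
  by rewrite /h /kk rmorphB /= -!pmulrn; ring.
have S2 : \sum_(j < n) (1 + `|h j + e|)^-1 <= 2 * harmonic_sum R n.
  by apply: le_trans (S (- e)); apply: ler_sum => j _; rewrite opprK.
have := pi_gt0 R; move: (S e) S2 (harmonic_sum_ge0 R n).
move: (\sum_(_ < _) _) (\sum_(_ < _) _) (harmonic_sum _ _) (@pi R) => x y H p.
by move=> *; nra.
Qed.

(** The Gram expansion is applied to [u^2] rather than [u]; the tensor amplitudes have squared L^2
    norm equal to the square of that of [g]. *)
Lemma weighted_L4_bound (del : R) (g : I -> R -> R) : 0 < del ->
  (forall i, mu.-integrable setT (EFin \o g i)) ->
  (forall i, mu.-integrable setT (EFin \o (fun x => g i x ^+ 2))) ->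
  (\int[prodm mu (prodm mu mu)]_p
     (wst del p * (osc_cos mu g thst p ^+ 2 + osc_sin mu g thst p ^+ 2) ^+ 2)%:E <=
   (256 * pi * harmonic_sum R n * (\sum_i \int[mu]_x (g i x ^+ 2)) ^+ 2)%:E)%E.
Proof.
move=> d0 ig ig2.
have ig' ij : (prodm mu mu).-integrable setT (EFin \o tensor2 g ij).
  exact: (integrable_tensor (ig ij.1) (ig ij.2)).
have mth2 ij : measurable_fun setT
    (fun q : (R * (R * R)) * (R * R) => phase2 thst ij q.1 q.2).
  apply: measurable_funD.
    apply: (measurableT_comp (measurable_thst ij.1)
      (g := fun q : (R * (R * R)) * (R * R) => (q.1, q.2.1))).
    by apply: measurable_fun_pair => //; exact: measurableT_comp.
  apply: (measurableT_comp (measurable_thst ij.2)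
    (g := fun q : (R * (R * R)) * (R * R) => (q.1, q.2.2))).
  by apply: measurable_fun_pair => //; exact: measurableT_comp.
have := integrable_gram (integrable_wst d0) ig' mth2.
have := Rintegral_gram (integrable_wst d0) ig' mth2.
have E p : osc_cos (prodm mu mu) (tensor2 g) (phase2 thst) p ^+ 2 +
   osc_sin (prodm mu mu) (tensor2 g) (phase2 thst) p ^+ 2 =
   (osc_cos mu g thst p ^+ 2 + osc_sin mu g thst p ^+ 2) ^+ 2.
  exact: (osc_sqr2 ig measurable_thst).
under eq_Rintegral do rewrite E.
under [X in integrable _ _ X -> _]eq_fun do rewrite E.
move=> RE iE; rewrite -[leLHS]fineK; last exact: integrable_fin_num.
rewrite lee_fin -[leLHS]/(Rintegral _ _ _) RE -(tensor2_sqr ig2).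
apply: (schur_test (mZ := prodm mu mu) (g := tensor2 g) (k := kern del)
  (kap := gram_kernel (prodm mu (prodm mu mu)) (wst del) (phase2 thst))).
- by move=> i j z; exact: gram_kernel_le.
- by move=> i j; exact: measurable_kern.
- by move=> ij; have /measurable_EFinP := measurable_int _ (ig' ij).
- move=> ij; have := integrable_tensor (ig2 ij.1) (ig2 ij.2).
  by apply: eq_integrable => // z _; rewrite /= /tensor2 exprMn.
- by move=> i z1; exact: schur_kern.
- move=> j z2; under eq_bigr do under eq_integral do rewrite kern_sym.
  exact: schur_kern.
Qed.

End strichartz_kernel.

(** * Approximation by Poisson kernels *)

Section poisson_approximation.
Variable R : realType.
Notation mu := (@lebesgue_measure R).

Lemma poisson_le (del s : R) : 0 < del -> poisson del s <= 2 / del.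
Proof.
move=> d0; rewrite /poisson.
have s0 := sqr_ge0 s; have e0 : 0 < del ^+ 2 by exact: exprn_gt0.
rewrite ler_pdivrMr ?ltr_wpDr// mulrAC ler_pdivlMr// -!mulrA ler_wpM2l//.
by rewrite -expr2 lerDl.
Qed.

(** Away from 0 the kernel is small compared with one of fixed width [r]. That one has mass 1, so
    tails are of order [del / r] without being integrated. *)
Lemma poisson_tail (del r s : R) : 0 < del -> 0 < r -> r <= `|s| ->
  poisson del s <= 2 * del / r * poisson r s.
Proof.
move=> d0 r0 rs; rewrite /poisson.
have rs2 : r ^+ 2 <= s ^+ 2.
  by rewrite -(real_normK (num_real s)) ler_sqr ?nnegrE ?(ltW r0)// ltW.
have e0 : 0 < del ^+ 2 by exact: exprn_gt0.
have f0 : 0 < r ^+ 2 by exact: exprn_gt0.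
have s0 := sqr_ge0 s.
rewrite (_ : 2 * del / r * (2 * r / (r ^+ 2 + s ^+ 2)) =
  (2 * del) * (2 / (r ^+ 2 + s ^+ 2))); last first.
  by field; rewrite (gt_eqF r0) gt_eqF// ltr_wpDr.
rewrite ler_wpM2l ?mulr_ge0 ?(ltW d0)// -[leRHS]invf_div lef_pV2 ?posrE.
- by rewrite ler_pdivrMr//; lra.
- by rewrite ltr_wpDr.
- by rewrite divr_gt0// ltr_wpDr.
Qed.

Definition smoothing (del : R) (h : R -> R) (z : R) : R :=
  \int[mu]_w (h w * poisson del (2 * pi * (z - w))).

Lemma measurable_poisson_pair (del : R) : 0 < del ->
  measurable_fun setT (fun z : R * R => poisson del (2 * pi * (z.1 - z.2))).
Proof.
move=> d0; apply: (measurableT_comp (measurable_poisson d0)).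
by apply: measurable_funM => //; exact: measurable_funB.
Qed.

Lemma integrable_poisson (del z : R) : 0 < del ->
  mu.-integrable setT (EFin \o (fun w => poisson del (2 * pi * (z - w)))).
Proof.
move=> d0; apply/integrableP; split.
  apply/measurable_EFinP.
  exact: (measurableT_comp (measurable_poisson_pair d0) (pair1_measurable z)).
under eq_integral => w _ do rewrite /= ger0_norm ?poisson_ge0//.
by rewrite integral_poisson// ltry.
Qed.

Lemma Rintegral_poisson (del z : R) : 0 < del ->
  \int[mu]_w poisson del (2 * pi * (z - w)) = 1.
Proof. by move=> d0; rewrite /Rintegral integral_poisson. Qed.

Lemma integrable_mul_le (d : measure_display) (T : measurableType d)
    (m : {measure set T -> \bar R}) (f h : T -> R) (C : R) :
  m.-integrable setT (EFin \o f) -> measurable_fun setT h ->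
  (forall x, `|h x| <= C) ->
  m.-integrable setT (EFin \o (fun x => f x * h x)).
Proof.
move=> intf mh hC; have /measurable_EFinP mf := measurable_int _ intf.
apply: le_integrable (integrableZl measurableT C intf) => //.
  by apply/measurable_EFinP/measurable_funM.
move=> x _ /=; rewrite lee_fin !normrM mulrC.
by rewrite ler_wpM2r// (le_trans (hC x))// ler_norm.
Qed.

Lemma smoothing_bound (del M : R) (h : R -> R) (z : R) : 0 < del ->
  (forall w, `|h w| <= M) -> `|smoothing del h z| <= M.
Proof.
move=> d0 hM; have M0 : 0 <= M by exact: le_trans (hM 0).
rewrite -lee_fin -[M%:E]mule1 -(integral_poisson z d0) -ge0_integralZl//; last 2 first.
- by case/integrableP : (integrable_poisson z d0).
- by move=> w _; rewrite lee_fin poisson_ge0.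
apply: normr_Rintegral_le => w _; rewrite normrM -EFinM lee_fin.
by rewrite (ger0_norm (poisson_ge0 _ d0)) ler_wpM2r// poisson_ge0.
Qed.

(** Where [|z - w| < r] the oscillation of [h] is at most [eta]; elsewhere it is at most [2 M] and
    the tail comparison contributes [2 * del / r]. *)
Lemma smoothing_dist (del M r eta : R) (h : R -> R) (z : R) : 0 < del ->
  measurable_fun setT h -> (forall w, `|h w| <= M) -> 0 < r -> 0 <= eta ->
  (forall w, `|z - w| < r -> `|h w - h z| <= eta) ->
  `|smoothing del h z - h z| <= eta + 4 * M / r * del.
Proof.
move=> d0 mh hM r0 eta0 hr; have M0 : 0 <= M by exact: le_trans (hM 0).
have iP := integrable_poisson z d0.
have ihP : mu.-integrable setT (EFin \o (fun w => h w * poisson del (2 * pi * (z - w)))).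
  have := integrable_mul_le iP mh hM.
  by apply: eq_integrable => // w _; rewrite /= mulrC.
have -> : smoothing del h z - h z =
    \int[mu]_w ((h w - h z) * poisson del (2 * pi * (z - w))).
  under eq_Rintegral => w _ do rewrite mulrBl.
  rewrite RintegralB//; last exact: (integrableZl measurableT (h z) iP).
  by rewrite RintegralZl// Rintegral_poisson// mulr1.
have iPr := integrable_poisson z r0.
have K0 : 0 <= 4 * M / r * del by rewrite mulr_ge0// ?divr_ge0 ?mulr_ge0// ltW.
have mP : measurable_fun setT (fun w : R => (poisson del (2 * pi * (z - w)))%:E).
  by case/integrableP : iP.
have mPr : measurable_fun setT (fun w : R => (poisson r (2 * pi * (z - w)))%:E).
  by case/integrableP : iPr.
rewrite -lee_fin EFinD -[eta%:E]mule1 -(integral_poisson z d0).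
rewrite -[(4 * M / r * del)%:E]mule1 -(integral_poisson z r0).
rewrite -!ge0_integralZl//; try (by move=> w _; rewrite lee_fin poisson_ge0).
rewrite -ge0_integralD//; last 4 first.
- by move=> w _; rewrite -EFinM lee_fin mulr_ge0// poisson_ge0.
- exact: measurable_funeM.
- by move=> w _; rewrite -EFinM lee_fin mulr_ge0// poisson_ge0.
- exact: measurable_funeM.
apply: normr_Rintegral_le => w _; rewrite -!EFinM -EFinD lee_fin normrM.
have P0 := poisson_ge0 (2 * pi * (z - w)) d0; have Pr0 := poisson_ge0 (2 * pi * (z - w)) r0.
rewrite (ger0_norm P0); have [zw|zw] := ltP `|z - w| r.
  by apply: ler_wpDr; [rewrite mulr_ge0|rewrite ler_wpM2r// hr].
apply: ler_wpDl; first by rewrite mulr_ge0.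
have hh : `|h w - h z| <= 2 * M.
  by rewrite (le_trans (ler_normB _ _))// mulr_natl mulr2n lerD.
apply: (@le_trans _ _ (2 * M * (2 * del / r * poisson r (2 * pi * (z - w))))).
  apply: ler_pM => //; apply: poisson_tail => //.
  rewrite normrM (le_trans zw)// ler_peMl// ger0_norm ?mulr_ge0 ?pi_ge0//.
  by have := pi_ge2 R; move: (@pi R) => p; lra.
rewrite le_eqVlt; apply/orP; left; apply/eqP; by field; rewrite gt_eqF.
Qed.

Lemma smoothing_cvg (M : R) (h : R -> R) (z : R) : measurable_fun setT h ->
  (forall w, `|h w| <= M) -> {for z, continuous h} ->
  smoothing m.+1%:R^-1 h z @[m --> \oo] --> h z.
Proof.
move=> mh hM ch; have M0 : 0 <= M by exact: le_trans (hM 0).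
apply/cvgrPdist_le => e e0.
have e2 : 0 < e / 2 by rewrite divr_gt0.
have /cvgrPdist_le /(_ _ e2) [r /= r0 hr] := ch.
have hr' w : `|z - w| < r -> `|h w - h z| <= e / 2.
  by move=> zw; rewrite distrC; apply: hr.
have C0 : 0 <= 4 * M / r by rewrite mulr_ge0 ?mulr_ge0// invr_ge0 ltW.
have c1 : (4 * M / r) * m.+1%:R^-1 @[m --> \oo] --> (4 * M / r) * 0.
  by apply: cvgMr; exact: cvg_harmonic.
rewrite mulr0 in c1; have /cvgrPdist_le /(_ _ e2) := c1.
apply: filterS => m; have m0 : 0 <= 4 * M / r * m.+1%:R^-1 by exact: mulr_ge0.
rewrite sub0r normrN (ger0_norm m0) => hm.
rewrite distrC (le_trans (smoothing_dist _ mh hM r0 (ltW e2) hr'))//.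
by rewrite [leRHS]splitr lerD2l.
Qed.

Section bilinear.
Implicit Types g h e : R -> R.

Definition smform (del : R) g h : R :=
  \int[prodm mu mu]_z (g z.1 * h z.2 * poisson del (2 * pi * (z.1 - z.2))).

Lemma integrable_smform (del : R) g h : 0 < del ->
  mu.-integrable setT (EFin \o g) -> mu.-integrable setT (EFin \o h) ->
  (prodm mu mu).-integrable setT
    (EFin \o (fun z => g z.1 * h z.2 * poisson del (2 * pi * (z.1 - z.2)))).
Proof.
move=> d0 ig ih; apply: (integrable_mul_le (C := 2 / del) (integrable_tensor ig ih)).
  exact: measurable_poisson_pair.
by move=> z; rewrite ger0_norm ?poisson_ge0// poisson_le.
Qed.

Lemma smform_smoothing (del : R) g h : 0 < del ->
  mu.-integrable setT (EFin \o g) -> mu.-integrable setT (EFin \o h) ->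
  smform del g h = \int[mu]_z (g z * smoothing del h z).
Proof.
move=> d0 ig ih; rewrite /smform -Rintegral12_prod/=; last exact: integrable_smform.
apply: eq_Rintegral => z _; rewrite /smoothing -RintegralZl//.
  by apply: eq_Rintegral => w _; rewrite mulrA.
apply: (integrable_mul_le (C := 2 / del) ih).
  exact: (measurableT_comp (measurable_poisson_pair d0) (pair1_measurable z)).
by move=> w; rewrite ger0_norm ?poisson_ge0// poisson_le.
Qed.

(** Schur's test on the index set [bool]: the only nonzero entry of the kernel couples
    [sqrt lam * g] with [e / sqrt lam], and its row and column sums are at most 1. *)
Lemma smform_amgm (del lam : R) g e : 0 < del -> 0 < lam ->
  measurable_fun setT g -> measurable_fun setT e ->
  mu.-integrable setT (EFin \o (fun x => g x ^+ 2)) ->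
  mu.-integrable setT (EFin \o (fun x => e x ^+ 2)) ->
  smform del g e <= lam * \int[mu]_x (g x ^+ 2) + lam^-1 * \int[mu]_x (e x ^+ 2).
Proof.
move=> d0 l0 mg me ig ie.
have sl0 : Num.sqrt lam != 0 by rewrite gt_eqF// sqrtr_gt0.
pose G (b : bool) (x : R) := if b then Num.sqrt lam * g x else (Num.sqrt lam)^-1 * e x.
pose kap (b c : bool) (z : R * R) : R :=
  if b && ~~ c then poisson del (2 * pi * (z.1 - z.2)) else 0.
have kap0 b c z : 0 <= kap b c z.
  by rewrite /kap; case: ifP => // _; exact: poisson_ge0.
have iG b : mu.-integrable setT (EFin \o (fun x => G b x ^+ 2)).
  case: b; rewrite /G.
    have := integrableZl measurableT (Num.sqrt lam ^+ 2) ig.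
    by apply: eq_integrable => // x _; rewrite /= exprMn.
  have := integrableZl measurableT ((Num.sqrt lam)^-1 ^+ 2) ie.
  by apply: eq_integrable => // x _; rewrite /= exprMn.
have sym (x z : R) : poisson del (2 * pi * (x - z)) = poisson del (2 * pi * (z - x)).
  by rewrite -(poissonN _ (_ * (z - x))) -mulrN opprB.
have H := @schur_test _ _ _ mu bool kap kap 1 G.
have : \sum_b \sum_c \int[prodm mu mu]_z (G b z.1 * G c z.2 * kap b c z) <=
    1 * \sum_b \int[mu]_z (G b z ^+ 2).
  apply: H.
  - by move=> b c z; rewrite (ger0_norm (kap0 b c z)).
  - move=> b c; rewrite /kap; case: (b && ~~ c); last exact: measurable_cst.
    exact: measurable_poisson_pair.
  - by move=> [|]; exact: measurable_funM.
  - exact: iG.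
  - move=> b z; rewrite big_bool /kap /=; case: b => /=.
      by rewrite integral0 add0e integral_poisson.
    by rewrite !integral0 adde0 lee_fin.
  - move=> c z; rewrite big_bool /kap /=; case: c => /=.
      by rewrite !integral0 adde0 lee_fin.
    rewrite integral0 adde0.
    under eq_integral => x _ do rewrite sym.
    by rewrite integral_poisson.
rewrite !big_bool /kap /= mul1r.
have zero (f : R * R -> R) : \int[prodm mu mu]_z (f z * 0) = 0.
  by under eq_Rintegral => z _ do rewrite mulr0; rewrite Rintegral_cst// mul0r.
rewrite !zero !addr0 !add0r /G.
rewrite (_ : \int[prodm mu mu]_z _ = smform del g e); last first.
  by apply: eq_Rintegral => z _; field.
move=> /le_trans; apply; apply: lerD.
  under eq_Rintegral => z _ do rewrite exprMn sqr_sqrtr ?(ltW l0)//.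
  by rewrite RintegralZl.
under eq_Rintegral => z _ do rewrite exprMn exprVn sqr_sqrtr ?(ltW l0)//.
by rewrite RintegralZl.
Qed.

Lemma Rintegral_amgm (lam : R) g e : 0 < lam ->
  mu.-integrable setT (EFin \o (fun x => g x * e x)) ->
  mu.-integrable setT (EFin \o (fun x => g x ^+ 2)) ->
  mu.-integrable setT (EFin \o (fun x => e x ^+ 2)) ->
  \int[mu]_x (g x * e x) <=
  lam * \int[mu]_x (g x ^+ 2) + lam^-1 * \int[mu]_x (e x ^+ 2).
Proof.
move=> l0 ige ig ie; rewrite -!RintegralZl// -RintegralD//; last 2 first.
  exact: (integrableZl measurableT lam ig).
  exact: (integrableZl measurableT lam^-1 ie).
apply: le_Rintegral => //.
  exact: (integrableD measurableT (integrableZl measurableT lam ig)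
    (integrableZl measurableT lam^-1 ie)).
move=> x _.
rewrite -subr_ge0 (_ : _ - _ = (lam * g x ^+ 2 + lam^-1 * (e x - lam * g x) ^+ 2
  + lam^-1 * e x ^+ 2) / 2 + lam * 0); last by by field; rewrite gt_eqF.
by rewrite mulr0 addr0 divr_ge0// !addr_ge0// mulr_ge0 ?sqr_ge0// ?invr_ge0 ltW.
Qed.

Let norm_le_quarter (eps x a b : R) : x <= a + b -> - x <= a + b ->
  a <= eps / 8 -> b <= eps / 8 -> `|x| <= eps / 4.
Proof. by move=> *; rewrite ler_norml; apply/andP; split; lra. Qed.

Let dist_split (eps x b c e : R) : 0 < eps -> `|x - b| <= eps / 4 ->
  `|b - c| <= eps / 4 -> `|e| <= eps / 4 -> `|x - (c + e)| <= eps.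
Proof.
move=> eps0; rewrite !ler_norml => /andP[? ?] /andP[? ?] /andP[? ?].
by apply/andP; split; lra.
Qed.

(** Only the second argument is replaced by a bounded continuous [h]. Then [smform g h] converges by
    dominated convergence, with majorant [M |g|], while the errors caused by [e = g - h] are small
    uniformly in [m]. *)
Lemma smform_cvg (g : R -> R) :
  mu.-integrable setT (EFin \o g) ->
  mu.-integrable setT (EFin \o (fun x => g x ^+ 2)) ->
  (forall eta : R, 0 < eta -> exists h : R -> R, exists M : R,
    [/\ continuous h, forall x, `|h x| <= M, mu.-integrable setT (EFin \o h) &
     (\int[mu]_x ((g x - h x) ^+ 2)%:E <= eta%:E)%E]) ->
  smform m.+1%:R^-1 g g @[m --> \oo] --> \int[mu]_x (g x ^+ 2).
Proof.
move=> ig ig2 happ; apply/cvgrPdist_le => eps eps0.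
set X := \int[mu]_x (g x ^+ 2).
have X0 : 0 <= X by apply: Rintegral_ge0 => x _; exact: sqr_ge0.
have /measurable_EFinP mg := measurable_int _ ig.
(* [lam] makes the [g] term of each weighted AM-GM bound at most [eps / 8]; the accuracy
   [lam * (eps / 8)] of [h] does so for the [e] term. *)
pose lam := eps / (8 * (X + 1)).
have X1 : 0 < 8 * (X + 1) by rewrite mulr_gt0// ltr_wpDl.
have l0 : 0 < lam by rewrite divr_gt0.
have lX : lam * X <= eps / 8.
  rewrite /lam invfM mulrA -mulrA ler_piMr ?divr_ge0 ?(ltW eps0)//.
  by rewrite mulrC ler_pdivrMr ?ltr_wpDl// mul1r lerDl.
have eta0 : 0 < lam * (eps / 8) by rewrite mulr_gt0// divr_gt0.
have [h [M [ch hM ih ghE]]] := happ _ eta0.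
have mh : measurable_fun setT h by exact: continuous_measurable_fun.
pose e x := g x - h x.
have me : measurable_fun setT e by exact: measurable_funB.
have ie : mu.-integrable setT (EFin \o e) by exact: (integrableB measurableT ig ih).
have ie2 : mu.-integrable setT (EFin \o (fun x => e x ^+ 2)).
  apply/integrableP; split; first by apply/measurable_EFinP; exact: measurable_funX.
  under eq_integral => x _ do rewrite /= ger0_norm ?sqr_ge0//.
  exact: le_lt_trans ghE (ltry _).
have igh : mu.-integrable setT (EFin \o (fun x => g x * h x)).
  exact: (integrable_mul_le ig mh hM).
have ige : mu.-integrable setT (EFin \o (fun x => g x * e x)).
  have := integrableB measurableT ig2 igh.
  by apply: eq_integrable => // x _; rewrite /= /e -EFinB; congr EFin; ring.
have E0 : \int[mu]_x (e x ^+ 2) <= lam * (eps / 8).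
  rewrite -lee_fin /Rintegral fineK//; exact: integrable_fin_num ie2.
have lE : lam^-1 * \int[mu]_x (e x ^+ 2) <= eps / 8.
  by rewrite mulrC ler_pdivrMr// mulrC.
have sqN : \int[mu]_x ((- e x) ^+ 2) = \int[mu]_x (e x ^+ 2).
  by apply: eq_Rintegral => x _; rewrite sqrrN.
have iNe2 : mu.-integrable setT (EFin \o (fun x => (- e x) ^+ 2)).
  by have := ie2; apply: eq_integrable => // x _; rewrite /= sqrrN.
have iNe : mu.-integrable setT (EFin \o (fun x => - e x)).
  by have := integrableN ie; apply: eq_integrable.
have B1 : `|X - \int[mu]_x (g x * h x)| <= eps / 4.
  rewrite /X -RintegralB//.
  rewrite (_ : \int[mu]_x (g x ^+ 2 - g x * h x) = \int[mu]_x (g x * e x)); last first.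
    by apply: eq_Rintegral => x _; rewrite /e; ring.
  have H1 := Rintegral_amgm l0 ige ig2 ie2.
  have H2 : - (\int[mu]_x (g x * e x)) <= lam * X + lam^-1 * \int[mu]_x (e x ^+ 2).
    have NE : \int[mu]_x (g x * - e x) = - (\int[mu]_x (g x * e x)).
      by rewrite -mulN1r -RintegralZl//; apply: eq_Rintegral => x _; ring.
    have iNge : mu.-integrable setT (EFin \o (fun x => g x * - e x)).
      have := integrableN ige.
      by apply: eq_integrable => // x _; rewrite /= mulrN.
    have H := Rintegral_amgm l0 iNge ig2 iNe2.
    by rewrite NE sqN in H; exact: H.
  exact: norm_le_quarter H1 H2 lX lE.
have cB : smform m.+1%:R^-1 g h @[m --> \oo] --> \int[mu]_x (g x * h x).
  under eq_fun => m do rewrite smform_smoothing//.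
  have idom := integrableZl measurableT M (integrable_norm ig).
  pose f_ (m : nat) (x : R) := (g x * smoothing m.+1%:R^-1 h x)%:E.
  have mf_ m : measurable_fun [set: R] (f_ m).
    apply/measurable_EFinP; apply: measurable_funM => //.
    apply: (measurable_Rintegral mu
      (f := fun z : R * R => h z.2 * poisson m.+1%:R^-1 (2 * pi * (z.1 - z.2)))).
    apply: measurable_funM; first exact: measurableT_comp.
    by apply: measurable_poisson_pair; rewrite invr_gt0.
  have mf : measurable_fun [set: R] (fun x => (g x * h x)%:E).
    by apply/measurable_EFinP; exact: measurable_funM.
  have f_f : {ae mu, forall x, [set: R] x -> f_ ^~ x @ \oo --> (g x * h x)%:E}.
    apply: aeW => x _; apply: cvg_EFin; first by apply: nearW.
    by apply: cvgMr; exact: (smoothing_cvg mh hM (ch x)).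
  have f_g : {ae mu, forall x (m : nat), [set: R] x -> (`|f_ m x| <= M%:E * `|g x|%:E)%E}.
    apply: aeW => x m _; rewrite /f_ abse_EFin -EFinM lee_fin normrM mulrC ler_wpM2r//.
    by apply: smoothing_bound => //; rewrite invr_gt0.
  have [_ _ H] := @dominated_convergence _ _ R mu setT measurableT f_
    (fun x => (g x * h x)%:E) (fun x => (M%:E * `|g x|%:E)%E) mf_ mf f_f idom f_g.
  apply: fine_cvg; rewrite fineK; last exact: integrable_fin_num igh.
  exact: H.
have e4 : 0 < eps / 4 by rewrite divr_gt0.
have /cvgrPdist_le /(_ _ e4) := cB.
apply: filterS => m Hm.
have d0 : 0 < m.+1%:R^-1 :> R by rewrite invr_gt0.
have split_form : smform m.+1%:R^-1 g g = smform m.+1%:R^-1 g h + smform m.+1%:R^-1 g e.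
  rewrite /smform -RintegralD//; last 2 first.
    exact: integrable_smform.
    exact: integrable_smform.
  by apply: eq_Rintegral => z _; rewrite /e; ring.
have H1 := smform_amgm d0 l0 mg me ig2 ie2.
have H2 : - smform m.+1%:R^-1 g e <= lam * X + lam^-1 * \int[mu]_x (e x ^+ 2).
  have NE : smform m.+1%:R^-1 g (fun x => - e x) = - smform m.+1%:R^-1 g e.
    rewrite -mulN1r /smform -RintegralZl//; last exact: integrable_smform.
    by apply: eq_Rintegral => z _; ring.
  have mNe : measurable_fun setT (fun x => - e x) by exact: measurableT_comp.
  have H := smform_amgm d0 l0 mg mNe ig2 iNe2.
  by rewrite NE sqN in H; exact: H.
rewrite split_form; apply: (dist_split eps0 B1 Hm).
exact: norm_le_quarter H1 H2 lX lE.
Qed.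

End bilinear.

End poisson_approximation.

(** * Removing the weights *)

Section measurable_osc.
Context (dY dZ : measure_display) (Y : measurableType dY) (Z : measurableType dZ)
  (R : realType).
Variables (mZ : {sigma_finite_measure set Z -> \bar R}).
Variables (I : finType) (g : I -> Z -> R) (th : I -> Y -> Z -> R).
Hypothesis mg : forall i, measurable_fun setT (g i).
Hypothesis mth : forall i, measurable_fun setT (fun p : Y * Z => th i p.1 p.2).

Lemma measurable_osc_cos : measurable_fun setT (osc_cos mZ g th).
Proof.
apply: measurable_sum => i.
apply: (measurable_Rintegral mZ (f := fun p : Y * Z => g i p.2 * cos (th i p.1 p.2))).
apply: measurable_funM; first exact: measurableT_comp.
by apply: measurableT_comp (mth i); exact: measurable_cos.
Qed.

Lemma measurable_osc_sin : measurable_fun setT (osc_sin mZ g th).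
Proof.
apply: measurable_sum => i.
apply: (measurable_Rintegral mZ (f := fun p : Y * Z => g i p.2 * sin (th i p.1 p.2))).
apply: measurable_funM; first exact: measurableT_comp.
by apply: measurableT_comp (mth i); exact: measurable_sin.
Qed.

Lemma measurable_osc_sqr :
  measurable_fun setT (fun y => osc_cos mZ g th y ^+ 2 + osc_sin mZ g th y ^+ 2).
Proof.
apply: measurable_funD; apply: measurable_funX.
- exact: measurable_osc_cos.
- exact: measurable_osc_sin.
Qed.

End measurable_osc.

Section weight_removal.
Variable R : realType.
Notation mu := (@lebesgue_measure R).

Lemma integral_wper (f : R -> \bar R) :
  (\int[mu]_(y in `[0%R, 1%R]) f y = \int[mu]_y ((wper y)%:E * f y))%E.
Proof.
rewrite integral_mkcond; apply: eq_integral => y _.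
by rewrite patchE /wper indicE; case: ifPn; rewrite ?mul1e ?mul0e.
Qed.

Lemma measurable_wper : measurable_fun [set: R] (@wper R).
Proof. exact: measurable_indic. Qed.

Lemma integral_wper_sp (f : R * R -> R) : measurable_fun setT f ->
  (forall p, 0 <= f p) ->
  (\int[mu]_x \int[mu]_(y in `[0%R, 1%R]) (f (x, y))%:E =
   \int[prodm mu mu]_p (wper p.2 * f p)%:E)%E.
Proof.
move=> mf f0; rewrite ge0_integral12_prod//=.
- apply: eq_integral => x _; rewrite integral_wper.
  by apply: eq_integral => y _; rewrite EFinM.
- apply/measurable_EFinP; apply: measurable_funM => //.
  by apply: (measurableT_comp measurable_wper).
- by move=> p; rewrite lee_fin mulr_ge0// wper_ge0.
Qed.

Lemma integral_wper_st (f : R * (R * R) -> R) : measurable_fun setT f ->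
  (forall p, 0 <= f p) ->
  (\int[mu]_(t in `[0%R, 1%R]) \int[mu]_x \int[mu]_(y in `[0%R, 1%R]) (f (t, (x, y)))%:E =
   \int[prodm mu (prodm mu mu)]_p (wper p.1 * (wper p.2.2 * f p))%:E)%E.
Proof.
move=> mf f0.
have mf2 t : measurable_fun setT (fun p : R * R => f (t, p)).
  exact: (measurableT_comp mf (pair1_measurable t)).
have mw : measurable_fun setT (fun p : R * R => wper p.2).
  by apply: (measurableT_comp measurable_wper).
have mwf t : measurable_fun setT (fun p : R * R => (wper p.2 * f (t, p))%:E).
  by apply/measurable_EFinP; exact: (measurable_funM mw (mf2 t)).
have mF : measurable_fun setT
    (fun p : R * (R * R) => (wper p.1 * (wper p.2.2 * f p))%:E).
  apply/measurable_EFinP; apply: measurable_funM.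
    exact: (measurableT_comp measurable_wper).
  by apply: measurable_funM => //; exact: (measurableT_comp mw).
have F0 (p : R * (R * R)) : (0 <= (wper p.1 * (wper p.2.2 * f p))%:E)%E.
  by rewrite lee_fin !mulr_ge0// wper_ge0.
rewrite [RHS](_ : _ =
    (\int[mu]_t \int[prodm mu mu]_q (wper t * (wper q.2 * f (t, q)))%:E)%E); last first.
  exact: (ge0_integral12_prod mu (prodm mu mu) mF F0).
rewrite integral_wper; apply: eq_integral => t _.
rewrite (integral_wper_sp (mf2 t))//.
have wf0 p : [set: R * R] p -> (0 <= (wper p.2 * f (t, p))%:E)%E.
  by rewrite lee_fin mulr_ge0// wper_ge0.
have w0 : (0 <= (wper t)%:E)%E by rewrite lee_fin wper_ge0.
apply: etrans.
  exact: (esym (ge0_integralZl (prodm mu mu) measurableT (mwf t) wf0 w0)).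
by apply: eq_integral => p _; rewrite EFinM.
Qed.

Lemma wexp_le1 (del x : R) : 0 <= del -> wexp del x <= 1.
Proof. by move=> d0; rewrite /wexp expR_le1 mulNr oppr_le0 mulr_ge0. Qed.

Lemma wexp_antitone (a b x : R) : a <= b -> wexp b x <= wexp a x.
Proof. by move=> ab; rewrite /wexp ler_expR ler_wpM2r// lerN2. Qed.

Lemma cvg_wexp (x : R) : wexp m.+1%:R^-1 x @[m --> \oo] --> (1 : R).
Proof.
have c : (- m.+1%:R^-1 * `|x|) @[m --> \oo] --> (0 : R).
  rewrite -(mul0r `|x|); apply: cvgMl; rewrite -oppr0; apply: cvgN.
  exact: cvg_harmonic.
by have := cvg_comp _ _ c (@continuous_expR R 0); rewrite expR0; apply.
Qed.

(** The bound [A] is uniform in [del], and the weights in [x] increase to 1 along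
    [del = 1 / (m + 1)], so monotone convergence applies. *)
Lemma weight_limit (f : R * (R * R) -> R) (A : R) : measurable_fun setT f ->
  (forall p, 0 <= f p) ->
  (forall del, 0 < del ->
    (\int[prodm mu (prodm mu mu)]_p (wst del p * f p)%:E <= A%:E)%E) ->
  (\int[mu]_(t in `[0%R, 1%R]) \int[mu]_x \int[mu]_(y in `[0%R, 1%R]) (f (t, (x, y)))%:E
   <= (expR 1 * A)%:E)%E.
Proof.
move=> mf f0 HA; rewrite integral_wper_st//.
pose F (m : nat) (p : R * (R * R)) : R :=
  wper p.1 * (wexp m.+1%:R^-1 p.2.1 * wper p.2.2 * f p).
have mw1 : measurable_fun setT (fun p : R * (R * R) => wper p.1).
  by apply: (measurableT_comp measurable_wper).
have mw2 : measurable_fun setT (fun p : R * (R * R) => wper p.2.2).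
  apply: (measurableT_comp measurable_wper); exact: measurableT_comp.
have mF m : measurable_fun setT (F m).
  apply: measurable_funM => //; apply: measurable_funM => //.
  apply: measurable_funM => //.
  apply: (measurableT_comp (f := wexp m.+1%:R^-1)); last exact: measurableT_comp.
  by apply: continuous_measurable_fun; exact: continuous_expabs.
have F0 m p : 0 <= F m p.
  by rewrite !mulr_ge0 ?wper_ge0// ltW// wexp_gt0.
have Fnd p : {homo (fun m => (F m p)%:E) : m n / (m <= n)%N >-> (m <= n)%E}.
  move=> m n mn; rewrite lee_fin /F ler_wpM2l ?wper_ge0// ler_wpM2r//.
  rewrite ler_wpM2r ?wper_ge0//; apply: wexp_antitone.
  by rewrite lef_pV2 ?posrE// ler_nat.
have E : (fun p : R * (R * R) => (wper p.1 * (wper p.2.2 * f p))%:E) =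
    (fun p : R * (R * R) => limn (fun m => (F m p)%:E)).
  apply/funext => p; apply/esym/cvg_lim => //; apply: cvg_EFin; first by apply: nearW.
  rewrite (_ : _ * (_ * _) = wper p.1 * (1 * wper p.2.2 * f p)); last by rewrite mul1r.
  by apply: cvgMr; apply: cvgMl; apply: cvgMl; exact: cvg_wexp.
have mFE m : measurable_fun setT (fun p => (F m p)%:E) by exact/measurable_EFinP.
have F0E (m : nat) p : [set: R * (R * R)] p -> (0 <= (F m p)%:E)%E by rewrite lee_fin.
rewrite [leLHS](_ : _ =
    limn (fun m => \int[prodm mu (prodm mu mu)]_p (F m p)%:E)%E); last first.
  rewrite E.
  exact: (monotone_convergence (prodm mu (prodm mu mu)) measurableT mFE F0E
    (fun p _ => Fnd p)).
apply: lime_le.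
  apply: ereal_nondecreasing_is_cvgn => m n mn.
  by apply: ge0_le_integral_nomeas => p _; [rewrite lee_fin|exact: Fnd].
apply: nearW => m.
have d0 : 0 < m.+1%:R^-1 :> R by rewrite invr_gt0.
rewrite EFinM; apply: (@le_trans _ _
  ((expR 1)%:E * \int[prodm mu (prodm mu mu)]_p (wst m.+1%:R^-1 p * f p)%:E)%E); last first.
  by apply: lee_wpmul2l; rewrite ?lee_fin ?expR_ge0//; exact: HA.
have mwf : measurable_fun setT (fun p => (wst m.+1%:R^-1 p * f p)%:E).
  apply/measurable_EFinP; apply: measurable_funM => //.
  by have /measurable_EFinP := measurable_int _ (integrable_wst d0).
have wf0 p : [set: R * (R * R)] p -> (0 <= (wst m.+1%:R^-1 p * f p)%:E)%E.
  by rewrite lee_fin mulr_ge0// wst_ge0.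
have e0 : (0 <= (expR 1)%:E :> \bar R)%E by rewrite lee_fin expR_ge0.
rewrite [leRHS](_ : _ = (\int[prodm mu (prodm mu mu)]_p
    ((expR 1)%:E * (wst m.+1%:R^-1 p * f p)%:E))%E); last first.
  exact: (esym (ge0_integralZl (prodm mu (prodm mu mu)) measurableT mwf wf0 e0)).
apply: ge0_le_integral_nomeas => p _; first by rewrite lee_fin.
rewrite -EFinM lee_fin /F /wst /wsp -!mulrA !(mulrA (expR 1)).
apply: ler_pM => //.
- by rewrite !mulr_ge0 ?wper_ge0// ltW// wexp_gt0.
- rewrite /wper indicE; have [|_] := boolP (p.1 \in _); last first.
    by rewrite mulr_ge0 ?expR_ge0// ltW// wexp_gt0.
  (* On [[0, 1]] one has [1 <= e * e^(-t)], the origin of the factor [expR 1]. *)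
  rewrite inE /= in_itv/= => /andP[t0 t1]; rewrite /wexp -expRD ger0_norm//.
  by rewrite -[leLHS]expR0 ler_expR mulN1r subr_ge0.
Qed.

End weight_removal.

(** * Lower bound for the L^2 norm at time 0 *)

Section L2_lower_bound.
Variable R : realType.
Notation mu := (@lebesgue_measure R).
Variables (n K : nat).
Let I := ('I_n * bool)%type.

Definition thsp (i : I) (p : R * R) (xi : R) : R := thst K i (0, p) xi.

Lemma measurable_thsp i : measurable_fun setT (fun q : (R * R) * R => thsp i q.1 q.2).
Proof.
have mq : measurable_fun setT (fun q : (R * R) * R => (((0 : R), q.1), q.2)).
  by apply: measurable_fun_pair => //; exact: measurable_fun_pair.
exact: (measurableT_comp (measurable_thst K i) mq).
Qed.

(** Distinct integer frequencies are orthogonal over a period; for equal ones the real and imaginary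
    data decouple because [cos (pi / 2) = 0]. *)
Lemma gram_kernel_sp (del : R) i j z : 0 < del ->
  gram_kernel (prodm mu mu) (wsp del) thsp i j z =
  (i == j)%:R * poisson del (2 * pi * (z.1 - z.2)).
Proof.
move=> d0; rewrite /gram_kernel.
pose c (b : bool) : R := if b then pi / 2 else 0.
under eq_Rintegral => p _.
  rewrite (_ : thsp i p z.1 - thsp j p z.2 =
    (2 * pi * (z.1 - z.2) * p.1 + 2 * pi * (kk K i.1 - kk K j.1)%:~R * p.2)
     + (c i.2 - c j.2)); last first.
    rewrite /thsp /thst /sphase -!/(c _) !(rmorphB, rmorphD) /=.
    move: (c _) (c _) => c1 c2.
    by move: (@pi R) => q; ring.
  over.
rewrite (even_mass_shift (K := poisson del (2 * pi * (z.1 - z.2)) *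
  (kk K i.1 - kk K j.1 == 0)%:R)).
- rewrite subr_eq0 (inj_eq (@kk_inj n K)); case: i j => [a b] [a' b'] /=.
  rewrite xpair_eqE; case: (a == a') => /=; last by rewrite mulr0 !mul0r.
  rewrite mulr1 mulrC; congr (_ * _); rewrite /c.
  by case: b b' => [|] [|] /=; rewrite ?subrr ?subr0 ?sub0r ?cosN ?cos0 ?cos_pihalf.
- exact: integrable_wsp.
- by apply: measurable_funD; apply: measurable_funM.
- exact: even_mass_wsp.
Qed.

(** The Gram form is diagonal, so the weighted norm is a sum of [smform (g i) (g i)]. It lies below
    the unweighted norm since [wexp <= 1], and tends to the left side as [del] tends to 0. *)
Lemma L2_lower_bound (g : I -> R -> R) :
  (forall i, mu.-integrable setT (EFin \o g i)) ->
  (forall i, mu.-integrable setT (EFin \o (fun x => g i x ^+ 2))) ->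
  (forall i (eta : R), 0 < eta -> exists h : R -> R, exists M : R,
    [/\ continuous h, forall x, `|h x| <= M, mu.-integrable setT (EFin \o h) &
     (\int[mu]_x ((g i x - h x) ^+ 2)%:E <= eta%:E)%E]) ->
  ((\sum_i \int[mu]_x (g i x ^+ 2))%:E <=
   \int[mu]_x \int[mu]_(y in `[0%R, 1%R])
     (osc_cos mu g thsp (x, y) ^+ 2 + osc_sin mu g thsp (x, y) ^+ 2)%:E)%E.
Proof.
move=> ig ig2 happ.
have mg i : measurable_fun setT (g i) by have /measurable_EFinP := measurable_int _ (ig i).
pose U p := osc_cos mu g thsp p ^+ 2 + osc_sin mu g thsp p ^+ 2.
have mU : measurable_fun setT U by exact: (measurable_osc_sqr mu mg measurable_thsp).
have U0 p : 0 <= U p by rewrite addr_ge0// sqr_ge0.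
rewrite (integral_wper_sp (f := U))//.
have H (m : nat) : ((\sum_i smform m.+1%:R^-1 (g i) (g i))%:E <=
    \int[prodm mu mu]_p (wper p.2 * U p)%:E)%E.
  have d0 : 0 < m.+1%:R^-1 :> R by rewrite invr_gt0.
  have RE : \int[prodm mu mu]_p (wsp m.+1%:R^-1 p * U p) =
      \sum_i \sum_j \int[prodm mu mu]_z (g i z.1 * g j z.2 *
        gram_kernel (prodm mu mu) (wsp m.+1%:R^-1) thsp i j z).
    exact: (Rintegral_gram (integrable_wsp d0) ig measurable_thsp).
  have iE := integrable_gram (integrable_wsp d0) ig measurable_thsp.
  have -> : \sum_i smform m.+1%:R^-1 (g i) (g i) =
      \int[prodm mu mu]_p (wsp m.+1%:R^-1 p * U p).
    rewrite RE; apply: eq_bigr => i _; rewrite (bigD1 i)//= big1 => [|j ji].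
      by rewrite addr0; apply: eq_Rintegral => z _; rewrite gram_kernel_sp// eqxx mul1r.
    under eq_Rintegral => z _ do rewrite gram_kernel_sp// eq_sym (negbTE ji) mul0r mulr0.
    by rewrite Rintegral_cst// mul0r.
  rewrite /Rintegral fineK; last exact: integrable_fin_num iE.
  apply: ge0_le_integral_nomeas => p _; first by rewrite lee_fin mulr_ge0// wsp_ge0.
  rewrite lee_fin ler_wpM2r// /wsp ler_piMl ?wper_ge0//.
  by apply: wexp_le1; rewrite ltW.
have cS : \sum_i smform m.+1%:R^-1 (g i) (g i) @[m --> \oo] -->
    \sum_i \int[mu]_x (g i x ^+ 2).
  elim: (index_enum _) => [|i s IH].
    by under eq_fun do rewrite big_nil; rewrite big_nil; exact: cvg_cst.
  under eq_fun do rewrite big_cons; rewrite big_cons; apply: cvgD => //.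
  by apply: smform_cvg => //; exact: happ.
move: H; case: (\int[prodm mu mu]_p (wper p.2 * U p)%:E)%E => [r| |] H.
- rewrite lee_fin; rewrite -(cvg_lim _ cS)//.
  apply: limr_le; first by apply/cvg_ex; eexists; exact: cS.
  by apply: nearW => m; have := H m; rewrite lee_fin.
- exact: leey.
- by have := H 0%N.
Qed.

End L2_lower_bound.

(** * Truncated Fourier transforms *)

Section cutoff_facts.
Variables (R : realType) (chi : R -> R).
Hypothesis hchi : cutoff chi.

Lemma cutoff_continuous : continuous chi.
Proof.
have [smc _ _ _] := hchi; move=> x.
by apply/differentiable_continuous/derivable1_diffP; exact: (smc 0%N x).
Qed.

Lemma cutoff_bounded : exists2 C : R, 0 < C & forall x, `|chi x| <= C.
Proof.
have [_ _ _ c0] := hchi.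
have cN : {within `[(-2 : R), 2], continuous (fun x => `|chi x|)}.
  by apply: continuous_subspaceT => x; apply: cvg_norm; exact: cutoff_continuous.
have [|c _ hc] := EVT_max _ cN; first by lra.
exists (`|chi c| + 1) => [|x]; first by rewrite ltr_wpDl.
have [x2|x2] := leP `|x| 2; last by rewrite c0 ?normr0 ?addr_ge0// ltW.
rewrite (le_trans (hc x _)) ?lerDl//; rewrite in_itv/=; rewrite ler_norml in x2.
by move: x2 => /andP[? ?]; apply/andP; split.
Qed.

End cutoff_facts.

Section truncated_fourier.
Variable R : realType.
Notation mu := (@lebesgue_measure R).

(** [|A| + |B|] dominates the integrand for every [xi], which gives continuity, and its integral is
    the bound [M]. *)
Lemma osc_param_continuous (A B : R * R -> R) (th : R -> R * R -> R) :
  (prodm mu mu).-integrable setT (EFin \o A) ->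
  (prodm mu mu).-integrable setT (EFin \o B) ->
  (forall xi, measurable_fun setT (th xi)) -> (forall p, continuous (th ^~ p)) ->
  continuous (fun xi => \int[prodm mu mu]_p (A p * cos (th xi p) + B p * sin (th xi p)))
  /\ exists M : R, forall xi,
     `|\int[prodm mu mu]_p (A p * cos (th xi p) + B p * sin (th xi p))| <= M.
Proof.
move=> iA iB mth cth.
pose f xi p := A p * cos (th xi p) + B p * sin (th xi p).
pose G p := `|A p| + `|B p|.
have iG : (prodm mu mu).-integrable setT (EFin \o G).
  exact: (integrableD measurableT (integrable_norm iA) (integrable_norm iB)).
have fG xi p : `|f xi p| <= G p.
  rewrite /f /G (le_trans (ler_normD _ _))// !normrM lerD// ler_piMr//.
    exact: cos_max.
  exact: sin_max.
have if_ xi : (prodm mu mu).-integrable setT (EFin \o f xi).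
  have i1 : (prodm mu mu).-integrable setT (EFin \o (fun p => A p * cos (th xi p))).
    apply: integrable_bounded_mul => //; last by move=> p; exact: cos_max.
    exact: (measurableT_comp (@measurable_cos R) (mth xi)).
  have i2 : (prodm mu mu).-integrable setT (EFin \o (fun p => B p * sin (th xi p))).
    apply: integrable_bounded_mul => //; last by move=> p; exact: sin_max.
    exact: (measurableT_comp (@measurable_sin R) (mth xi)).
  exact: (integrableD measurableT i1 i2).
split.
  move=> xi.
  have H := @continuity_under_integral R _ _ (prodm mu mu) f setT measurableT (xi - 1) (xi + 1).
  apply: H.
  - by move=> x _; exact: if_.
  - apply: aeW => p _ x _.
    apply: cvgD; apply: cvgMr.
      apply: (@continuous_comp _ _ _ (th ^~ p) cos); first exact: cth.
      exact: continuous_cos.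
    apply: (@continuous_comp _ _ _ (th ^~ p) sin); first exact: cth.
    exact: continuous_sin.
  - exact: iG.
  - by move=> x _; apply: aeW => p _; exact: fG.
  - by rewrite inE /= in_itv/=; apply/andP; split; lra.
exists (\int[prodm mu mu]_p G p) => xi.
apply: (le_trans (le_normr_Rintegral measurableT (if_ xi))).
by apply: le_Rintegral => //; exact: integrable_norm.
Qed.

Variables (a b : R -> R -> R).
Hypothesis hab : L2M a b.

Let box (n : nat) (p : R * R) : R := \1_`[- n%:R, n%:R] p.1 * wper p.2.

Let ma : measurable_fun setT (fun p : R * R => a p.1 p.2).
Proof. by case: hab. Qed.
Let mb : measurable_fun setT (fun p : R * R => b p.1 p.2).
Proof. by case: hab. Qed.

Let ibox n : (prodm mu mu).-integrable setT (EFin \o box n).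
Proof.
exact: (integrable_tensor (integrable_indic_itv _ _ _ _) (@integrable_wper R)).
Qed.

Let iL2 : (prodm mu mu).-integrable setT
  (EFin \o (fun p => wper p.2 * (a p.1 p.2 ^+ 2 + b p.1 p.2 ^+ 2))).
Proof.
have mf : measurable_fun setT (fun p : R * R => a p.1 p.2 ^+ 2 + b p.1 p.2 ^+ 2).
  by apply: measurable_funD; exact: measurable_funX.
have f0 (p : R * R) : 0 <= a p.1 p.2 ^+ 2 + b p.1 p.2 ^+ 2 by rewrite addr_ge0// sqr_ge0.
apply/integrableP; split.
  apply/measurable_EFinP; apply: measurable_funM => //.
  exact: (measurableT_comp (@measurable_wper R)).
under eq_integral => p _ do rewrite /= ger0_norm ?mulr_ge0 ?wper_ge0//.
by rewrite -(integral_wper_sp mf f0); case: hab.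
Qed.

(** The majorant is [box n] plus the integrable function of [iL2]: on a bounded box, square
    integrability yields integrability. *)
Let ibox_mul n (f : R * R -> R) : measurable_fun setT f ->
  (forall p, `|f p| <= 1 + (a p.1 p.2 ^+ 2 + b p.1 p.2 ^+ 2)) ->
  (prodm mu mu).-integrable setT (EFin \o (fun p => box n p * f p)).
Proof.
move=> mf fle.
have /measurable_EFinP mbox := measurable_int _ (ibox n).
apply: le_integrable (integrableD measurableT (ibox n) iL2) => //.
  by apply/measurable_EFinP; exact: measurable_funM.
move=> p _ /=; rewrite lee_fin normrM.
have b0 : 0 <= \1_`[- n%:R, n%:R] p.1 :> R by [].
have b1 : \1_`[- n%:R, n%:R] p.1 <= 1 :> R by rewrite indicE; case: (_ \in _).
have w0 := wper_ge0 p.2; have f0 := normr_ge0 (f p); have := fle p.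
have s0 : 0 <= a p.1 p.2 ^+ 2 + b p.1 p.2 ^+ 2 by rewrite addr_ge0// sqr_ge0.
rewrite /box ger0_norm ?mulr_ge0//.
move: (a _ _ ^+ 2 + _) s0 (\1__ _) b0 b1 (wper _) w0 `|f p| f0.
move=> s s0 i i0 i1 w w0 F F0 Fs.
rewrite ger0_norm; last by rewrite addr_ge0 ?mulr_ge0.
apply: (@le_trans _ _ (i * w * (1 + s))); first by rewrite ler_wpM2l// mulr_ge0.
rewrite mulrDr mulr1 lerD2l -mulrA ler_piMl//.
by rewrite mulr_ge0.
Qed.

Let Rint_box n (f : R * R -> R) :
  (prodm mu mu).-integrable setT (EFin \o (fun p => box n p * f p)) ->
  Rintegral mu `[- n%:R, n%:R] (fun x => Rintegral mu `[0%R, 1%R] (fun y => f (x, y))) =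
  \int[prodm mu mu]_p (box n p * f p).
Proof.
move=> ib; apply: etrans (Rintegral12_prod ib).
rewrite Rintegral_mkcond; apply: eq_Rintegral => x _.
rewrite patchE [in RHS]/box /=; under [RHS]eq_Rintegral do rewrite indicE.
case: (x \in _) => /=; last first.
  by under eq_Rintegral do rewrite !mul0r; rewrite Rintegral_cst// mul0r.
rewrite Rintegral_mkcond; apply: eq_Rintegral => y _.
by rewrite patchE /wper indicE; case: (y \in _); rewrite ?mul1r ?mul0r.
Qed.

Let ab_le (p : R * R) :
  `|a p.1 p.2| + `|b p.1 p.2| <= 1 + (a p.1 p.2 ^+ 2 + b p.1 p.2 ^+ 2).
Proof.
rewrite -(real_normK (num_real (a p.1 p.2))) -(real_normK (num_real (b p.1 p.2))).
have := sqr_ge0 (`|a p.1 p.2| - 1); have := sqr_ge0 (`|b p.1 p.2| - 1).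
have := sqr_ge0 `|a p.1 p.2|; have := sqr_ge0 `|b p.1 p.2|.
by move: `|a p.1 p.2| `|b p.1 p.2| => x y; nra.
Qed.

Let mphase xi (k : int) : measurable_fun setT (fun p : R * R => phase xi p.1 k p.2).
Proof.
by apply: measurable_funM => //; apply: measurable_funD; apply: measurable_funM.
Qed.

Let cphase (k : int) (p : R * R) : continuous (fun xi => phase xi p.1 k p.2).
Proof.
move=> xi; apply: cvgMr; apply: cvgD; last exact: cvg_cst.
by apply: cvgMl; exact: cvg_id.
Qed.

Let trunc_regular n k (u v : R -> R -> R) :
  measurable_fun setT (fun p : R * R => u p.1 p.2) ->
  measurable_fun setT (fun p : R * R => v p.1 p.2) ->
  (forall p : R * R, `|u p.1 p.2| + `|v p.1 p.2| <=
     1 + (a p.1 p.2 ^+ 2 + b p.1 p.2 ^+ 2)) ->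
  continuous (fun xi => Rintegral mu `[- n%:R, n%:R] (fun x =>
    Rintegral mu `[0%R, 1%R] (fun y =>
      u x y * cos (phase xi x k y) + v x y * sin (phase xi x k y)))) /\
  exists M : R, forall xi, `|Rintegral mu `[- n%:R, n%:R] (fun x =>
    Rintegral mu `[0%R, 1%R] (fun y =>
      u x y * cos (phase xi x k y) + v x y * sin (phase xi x k y)))| <= M.
Proof.
move=> mu_ mv uv.
have iA : (prodm mu mu).-integrable setT (EFin \o (fun p => box n p * u p.1 p.2)).
  by apply: ibox_mul => // p; apply: le_trans (uv p); rewrite lerDl.
have iB : (prodm mu mu).-integrable setT (EFin \o (fun p => box n p * v p.1 p.2)).
  by apply: ibox_mul => // p; apply: le_trans (uv p); rewrite lerDr.
have H := osc_param_continuous (th := fun xi (p : R * R) => phase xi p.1 k p.2)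
  iA iB (fun xi => mphase xi k) (fun p => @cphase k p).
have E xi : Rintegral mu `[- n%:R, n%:R] (fun x =>
    Rintegral mu `[0%R, 1%R] (fun y =>
      u x y * cos (phase xi x k y) + v x y * sin (phase xi x k y))) =
    \int[prodm mu mu]_p
    (box n p * u p.1 p.2 * cos (phase xi p.1 k p.2) +
     box n p * v p.1 p.2 * sin (phase xi p.1 k p.2)).
  rewrite (@Rint_box n (fun p => u p.1 p.2 * cos (phase xi p.1 k p.2) +
    v p.1 p.2 * sin (phase xi p.1 k p.2))).
    by apply: eq_Rintegral => p _; ring.
  apply: ibox_mul => [|p].
    apply: measurable_funD; apply: measurable_funM => //.
      exact: (measurableT_comp (@measurable_cos R) (mphase xi k)).
    exact: (measurableT_comp (@measurable_sin R) (mphase xi k)).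
  apply: le_trans (uv p); rewrite (le_trans (ler_normD _ _))// !normrM.
  by rewrite lerD// ler_piMr// ?cos_max ?sin_max.
have [H1 [M HM]] := H; split.
  by rewrite (funext E).
by exists M => xi; rewrite E.
Qed.

Lemma trunc_FT_re_regular n k : continuous (fun xi => trunc_FT_re a b n xi k) /\
  exists M : R, forall xi, `|trunc_FT_re a b n xi k| <= M.
Proof. exact: (trunc_regular n k ma mb ab_le). Qed.

Lemma trunc_FT_im_regular n k : continuous (fun xi => trunc_FT_im a b n xi k) /\
  exists M : R, forall xi, `|trunc_FT_im a b n xi k| <= M.
Proof.
have E xi : trunc_FT_im a b n xi k = Rintegral mu `[- n%:R, n%:R] (fun x =>
    Rintegral mu `[0%R, 1%R] (fun y =>
      b x y * cos (phase xi x k y) + (- a x y) * sin (phase xi x k y))).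
  apply: eq_Rintegral => x _; apply: eq_Rintegral => y _.
  by rewrite mulNr.
have mNa : measurable_fun setT (fun p : R * R => - a p.1 p.2) by exact: measurableT_comp.
have [|H1 [M HM]] := @trunc_regular n k b (fun x y => - a x y) mb mNa.
  by move=> p; rewrite normrN addrC.
split; first by rewrite (funext E).
by exists M => xi; rewrite E.
Qed.

End truncated_fourier.

Section fourier_data.
Variables (R : realType) (chi : R -> R).
Hypothesis hchi : cutoff chi.
Notation mu := (@lebesgue_measure R).
Variables (N : R) (a b : R -> R -> R) (Fr Fi : R -> int -> R).
Hypotheses (N1 : 1 <= N) (hab : L2M a b) (hF : is_FT a b Fr Fi).

Let dist n k (xi : R) : R := (trunc_FT_re a b n xi k - Fr xi k) ^+ 2
             + (trunc_FT_im a b n xi k - Fi xi k) ^+ 2.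

(** A single [k] is bounded by the sum over all [k], which tends to 0; [fine_cvgP] also provides an
    index at which that sum is finite. *)
Let dist_small (k : int) (eta : R) : 0 < eta ->
  exists n : nat, (\int[mu]_xi (dist n k xi)%:E <= eta%:E)%E.
Proof.
move=> eta0; have [_ _] := hF.
move=> /fine_cvgP[fin /cvgrPdist_le /(_ _ eta0) H].
have [n [nfin Hn]] := @filter_ex _ _ _ _ (filterI fin H).
exists n; apply: (@le_trans _ _ (\esum_(k in [set: int]) \int[mu]_xi (dist n k xi)%:E)%E).
  apply: esum_ge; exists [set k]; first by split.
  by rewrite fsbig_set1.
rewrite /= in nfin Hn; rewrite -(fineK nfin) lee_fin.
by move: Hn; rewrite sub0r normrN; apply: le_trans; exact: ler_norm.
Qed.

Definition cutoff_mult (k : int) (xi : R) := chi (xi / N) * chi (k%:~R / N).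
Definition cutoff_coef (k : int) (c : bool) (xi : R) :=
  cutoff_mult k xi * (if c then Fi xi k else Fr xi k).

Let N0 : 0 < N. Proof. exact: lt_le_trans N1. Qed.

Let cmult k : continuous (cutoff_mult k).
Proof.
move=> x; apply: cvgMl; apply: (@continuous_comp _ _ _ (fun x : R => x / N) chi).
  by apply: cvgMl; exact: cvg_id.
exact: cutoff_continuous.
Qed.

Let mult_supp k (xi : R) : 2 * N < `|xi| -> cutoff_mult k xi = 0.
Proof.
have [_ _ _ c0] := hchi; move=> h; rewrite /cutoff_mult c0 ?mul0r//.
by rewrite normrM (ger0_norm (x := N^-1)) ?invr_ge0 ?(ltW N0)// ler_pdivlMr// ltW.
Qed.

Let ind (xi : R) : R := \1_`[- (2 * N), 2 * N] xi.

Let indE (xi : R) : `|xi| <= 2 * N -> ind xi = 1.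
Proof.
by rewrite /ind indicE ler_norml => h; rewrite mem_set.
Qed.

Let iind : mu.-integrable setT (EFin \o ind).
Proof. exact: integrable_indic_itv. Qed.

(** All three properties come from comparison with [h n], the cutoff times the transform of a
    truncation: it is continuous, bounded, and zero for [|xi| > 2 N]. Square integrability follows
    from [g^2 <= 2 (g - h)^2 + 2 h^2], integrability from [|g| <= 1 + g^2] on the support. *)
Lemma fourier_data (k : int) (c : bool) :
  [/\ mu.-integrable setT (EFin \o cutoff_coef k c),
   mu.-integrable setT (EFin \o (fun x => cutoff_coef k c x ^+ 2)) &
   forall eta : R, 0 < eta -> exists h : R -> R, exists M : R,
    [/\ continuous h, forall x, `|h x| <= M, mu.-integrable setT (EFin \o h) &
     (\int[mu]_x ((cutoff_coef k c x - h x) ^+ 2)%:E <= eta%:E)%E]].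
Proof.
have [C C0 hC] := cutoff_bounded hchi.
have multC xi : `|cutoff_mult k xi| <= C ^+ 2 by rewrite normrM expr2 ler_pM.
have mmult : measurable_fun setT (cutoff_mult k) by exact: continuous_measurable_fun.
have mcoef : measurable_fun setT (cutoff_coef k c).
  apply: measurable_funM => //.
  by have [m1 m2 _] := hF; case: (c); [exact: m2|exact: m1].
pose T n xi := if c then trunc_FT_im a b n xi k else trunc_FT_re a b n xi k.
have regT n : continuous (T n) /\ exists M : R, forall xi, `|T n xi| <= M.
  by rewrite /T; case: (c); [exact: trunc_FT_im_regular|exact: trunc_FT_re_regular].
pose h n xi := cutoff_mult k xi * T n xi.
have ch n : continuous (h n).
  by move=> x; apply: cvgM; [exact: cmult|exact: (regT n).1].
have mh n : measurable_fun setT (h n) by exact: continuous_measurable_fun.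
have ind0 xi : 0 <= ind xi by [].
have bh n : exists M : R, forall xi, `|h n xi| <= M * ind xi.
  have [_ [M HM]] := regT n; exists (C ^+ 2 * M) => xi.
  have [xN|xN] := leP `|xi| (2 * N).
    by rewrite indE// mulr1 normrM ler_pM.
  have M0 : 0 <= M by exact: le_trans (HM 0).
  rewrite /h mult_supp// mul0r normr0; apply: mulr_ge0 => //.
  by apply: mulr_ge0 => //; exact: sqr_ge0.
have ih n : mu.-integrable setT (EFin \o h n).
  have [M HM] := bh n.
  apply: le_integrable (integrableZl measurableT M iind) => //.
    by apply/measurable_EFinP; exact: mh.
  by move=> x _ /=; rewrite lee_fin (le_trans (HM x))// ler_norm.
have dE n : (\int[mu]_x ((cutoff_coef k c x - h n x) ^+ 2)%:E <=
    (C ^+ 4)%:E * \int[mu]_xi (dist n k xi)%:E)%E.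
  have mdist : measurable_fun setT (fun xi => (dist n k xi)%:E).
    have [m1 m2 _] := hF; apply/measurable_EFinP.
    apply: measurable_funD; apply: measurable_funX; apply: measurable_funB => //.
      exact: continuous_measurable_fun (trunc_FT_re_regular hab n k).1.
    exact: continuous_measurable_fun (trunc_FT_im_regular hab n k).1.
  rewrite -ge0_integralZl//; last 2 first.
  - by move=> x _; rewrite lee_fin addr_ge0// sqr_ge0.
  - by rewrite lee_fin exprn_ge0// ltW.
  apply: ge0_le_integral_nomeas => x _; first by rewrite lee_fin sqr_ge0.
  rewrite -EFinM lee_fin /cutoff_coef /h -mulrBr exprMn.
  rewrite (_ : C ^+ 4 = (C ^+ 2) ^+ 2); last by rewrite -exprM.
  apply: ler_pM; rewrite ?sqr_ge0//.
    by rewrite -(real_normK (num_real (cutoff_mult k x))) ler_sqr ?nnegrE ?exprn_ge0 ?(ltW C0).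
  by rewrite /dist /T -sqrrN opprB; case: (c); rewrite ?lerDl ?lerDr sqr_ge0.
have C4 : 0 < C ^+ 4 by exact: exprn_gt0.
have app eta : 0 < eta -> exists n, (\int[mu]_x ((cutoff_coef k c x - h n x) ^+ 2)%:E <= eta%:E)%E.
  move=> eta0; have [n Hn] := @dist_small k (eta / C ^+ 4) (divr_gt0 eta0 C4).
  exists n; apply: le_trans (dE n) _.
  have -> : eta%:E = ((C ^+ 4)%:E * (eta / C ^+ 4)%:E)%E.
    by rewrite -EFinM mulrCA divff ?mulr1// gt_eqF.
  by apply: lee_wpmul2l => //; rewrite lee_fin ltW.
have ic2 : mu.-integrable setT (EFin \o (fun x => cutoff_coef k c x ^+ 2)).
  have [n Hn] := app 1 ltr01; have [M HM] := bh n.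
  have id2 : mu.-integrable setT (EFin \o (fun x => (cutoff_coef k c x - h n x) ^+ 2)).
    apply/integrableP; split.
      by apply/measurable_EFinP; apply: measurable_funX;
        exact: (measurable_funB mcoef (mh n)).
    under eq_integral => x _ do rewrite /= ger0_norm ?sqr_ge0//.
    exact: le_lt_trans Hn (ltry _).
  have i2 := integrableD measurableT (integrableZl measurableT 2 id2)
    (integrableZl measurableT (2 * M ^+ 2) iind).
  apply: le_integrable i2 => //.
    by apply/measurable_EFinP; exact: measurable_funX.
  move=> x _ /=; rewrite lee_fin ger0_norm ?sqr_ge0//.
  have s1 : 0 <= 2 * (cutoff_coef k c x - h n x) ^+ 2 by rewrite mulr_ge0// sqr_ge0.
  have s2 : 0 <= 2 * M ^+ 2 * ind x by rewrite mulr_ge0// mulr_ge0// sqr_ge0.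
  rewrite (ger0_norm (addr_ge0 s1 s2)).
  have hx : h n x ^+ 2 <= M ^+ 2 * ind x.
    have indsq : ind x ^+ 2 = ind x.
      by rewrite /ind indicE; case: (_ \in _); rewrite ?expr1n ?expr0n.
    rewrite -indsq -exprMn -(real_normK (num_real (h n x))) ler_sqr ?nnegrE//.
    exact: le_trans (HM x).
  have := sqr_ge0 (cutoff_coef k c x - 2 * h n x).
  by move: (cutoff_coef k c x) (h n x) (ind x) (M ^+ 2) hx => u v i m; nra.
split => //.
  apply: le_integrable (integrableD measurableT iind ic2) => //.
    exact/measurable_EFinP.
  move=> x _ /=; rewrite lee_fin (ger0_norm (addr_ge0 (ind0 x) (sqr_ge0 _))).
  have [xN|xN] := leP `|x| (2 * N); last first.
    by rewrite /cutoff_coef mult_supp// mul0r normr0 addr_ge0 ?sqr_ge0.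
  rewrite indE// -(real_normK (num_real (cutoff_coef k c x))).
  have := sqr_ge0 (`|cutoff_coef k c x| - 1); have := sqr_ge0 `|cutoff_coef k c x|.
  by move: `|cutoff_coef k c x| => u; nra.
move=> eta eta0; have [n Hn] := app eta eta0; have [M HM] := bh n.
exists (h n), `|M|; split => // x; rewrite (le_trans (HM x))//.
rewrite (le_trans (ler_norm _))// normrM ler_piMr// ger0_norm//.
by rewrite /ind indicE; case: (_ \in _).
Qed.

End fourier_data.

(** * The Strichartz estimate *)

Section assembly.
Variable R : realType.
Notation mu := (@lebesgue_measure R).

(** From [e * ln x = ln (x^e) <= x^e]: a small power replaces the logarithm, at the price of [1 / e]
    in the constant. *)
Lemma harmonic_sum_powR (e : R) (n : nat) : 0 < e ->
  harmonic_sum R n.+1 <= (1 + e^-1) * n.+1%:R `^ e.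
Proof.
move=> e0; apply: (le_trans (harmonic_sum_ln R n)).
have n1 : 1 <= n.+1%:R :> R by rewrite ler1n.
have p1 : 1 <= n.+1%:R `^ e :> R.
  apply: (@le_trans _ _ (n.+1%:R `^ 0)); first by rewrite powRr0.
  by apply: ler_powR => //; rewrite ltW.
rewrite mulrDl mul1r lerD//.
rewrite mulrC ler_pdivlMr// mulrC -ln_powR ltW// ln_sublinear//.
Qed.

(** [2 (trunc (2 N) + 1) + 1 <= 4 N + 3], and [3 <= 3 N]. *)
Lemma bigK_le (N : R) : 1 <= N -> (2 * bigK N).+1%:R <= 7 * N.
Proof.
move=> N1; have h : (Num.truncn (2 * N))%:R <= 2 * N by rewrite truncn_le; lra.
by rewrite /bigK -natr1 natrM -natr1; lra.
Qed.

(** Here [s] is a squared L^2 norm, so the fourth root of [s^2] is the norm itself. *)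
Lemma powR_quarter (D M s e : R) : 0 <= D -> 0 <= M -> 0 <= s ->
  (D * M `^ (4 * e) * s ^+ 2) `^ 4^-1 = D `^ 4^-1 * M `^ e * s `^ 2^-1.
Proof.
move=> D0 M0 s0.
rewrite -[s ^+ 2]powR_mulrn// (powRM _ (mulr_ge0 D0 (powR_ge0 _ _)) (powR_ge0 _ _)).
rewrite (powRM _ D0 (powR_ge0 _ _)) -!powRrM.
by congr (_ * _ `^ _ * _ `^ _); field.
Qed.

Variables (chi : R -> R).
Hypothesis hchi : cutoff chi.
Variables (N : R) (a b : R -> R -> R) (Fr Fi : R -> int -> R).
Hypotheses (N1 : 1 <= N) (hab : L2M a b) (hF : is_FT a b Fr Fi).

Let n := (2 * bigK N).+1.
Let K := bigK N.
Let I := ('I_n * bool)%type.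

Definition freq_data (i : I) : R -> R := cutoff_coef chi N Fr Fi (kk K i.1) i.2.

Let ig i : mu.-integrable setT (EFin \o freq_data i).
Proof. by have [] := fourier_data hchi N1 hab hF (kk K i.1) i.2. Qed.

Let ith i (f : R -> R) : (forall x, `|f x| <= 1) ->
  measurable_fun setT f -> mu.-integrable setT (EFin \o (fun xi => freq_data i xi * f xi)).
Proof. by move=> f1 mf; exact: integrable_bounded_mul. Qed.

Let mth i p : measurable_fun setT (@thst R n K i p).
Proof. exact: (measurableT_comp (measurable_thst K i) (pair1_measurable p)). Qed.

(** The two flags recombine through [cos (x + pi / 2) = - sin x] into the real part of
    [(Fr + i Fi) e^(i x)]. *)
Lemma evol_reE t x y :
  evol_re chi N Fr Fi t x y = osc_cos mu freq_data (thst K) (t, (x, y)).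
Proof.
rewrite /evol_re /osc_cos big_mkord -(pair_big xpredT xpredT (fun j c =>
  \int[mu]_z (freq_data (j, c) z * cos (thst K (j, c) (t, (x, y)) z)))) /=.
apply: eq_bigr => j _; rewrite big_bool /= -RintegralD//; last 2 first.
- apply: ith => //; first by move=> z; exact: cos_max.
  exact: (measurableT_comp (@measurable_cos R) (mth _ _)).
- apply: ith => //; first by move=> z; exact: cos_max.
  exact: (measurableT_comp (@measurable_cos R) (mth _ _)).
apply: eq_Rintegral => xi _; rewrite /freq_data /cutoff_coef /cutoff_mult /thst /=.
rewrite addr0 cosDpihalf -/(kof N j) /kk -/(kof N j); ring.
Qed.

Lemma evol_imE t x y :
  evol_im chi N Fr Fi t x y = osc_sin mu freq_data (thst K) (t, (x, y)).
Proof.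
rewrite /evol_im /osc_sin big_mkord -(pair_big xpredT xpredT (fun j c =>
  \int[mu]_z (freq_data (j, c) z * sin (thst K (j, c) (t, (x, y)) z)))) /=.
apply: eq_bigr => j _; rewrite big_bool /= -RintegralD//; last 2 first.
- apply: ith => //; first by move=> z; exact: sin_max.
  exact: (measurableT_comp (@measurable_sin R) (mth _ _)).
- apply: ith => //; first by move=> z; exact: sin_max.
  exact: (measurableT_comp (@measurable_sin R) (mth _ _)).
apply: eq_Rintegral => xi _; rewrite /freq_data /cutoff_coef /cutoff_mult /thst /=.
rewrite addr0 sinDpihalf -/(kof N j) /kk -/(kof N j); ring.
Qed.

Let X := \sum_i \int[mu]_x (freq_data i x ^+ 2).

Lemma data_L2_le : (X%:E <= \int[mu]_x \int[mu]_(y in `[0%R, 1%R])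
     ((evol_re chi N Fr Fi 0 x y) ^+ 2 + (evol_im chi N Fr Fi 0 x y) ^+ 2)%:E)%E.
Proof.
have H := @L2_lower_bound R n K freq_data ig.
apply: le_trans (H _ _) _.
- by move=> i; have [] := fourier_data hchi N1 hab hF (kk K i.1) i.2.
- by move=> i; have [] := fourier_data hchi N1 hab hF (kk K i.1) i.2.
rewrite le_eqVlt; apply/orP; left; apply/eqP.
apply: eq_integral => x _; apply: eq_integral => y _.
by rewrite evol_reE evol_imE.
Qed.

Lemma evol_L4_le : (\int[mu]_(t in `[0%R, 1%R]) \int[mu]_x \int[mu]_(y in `[0%R, 1%R])
     (((evol_re chi N Fr Fi t x y) ^+ 2 + (evol_im chi N Fr Fi t x y) ^+ 2) ^+ 2)%:E <=
  (expR 1 * (256 * pi * harmonic_sum R n * X ^+ 2))%:E)%E.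
Proof.
have ig2 i : mu.-integrable setT (EFin \o (fun x => freq_data i x ^+ 2)).
  by have [] := fourier_data hchi N1 hab hF (kk K i.1) i.2.
have mg i : measurable_fun setT (freq_data i) by have /measurable_EFinP := measurable_int _ (ig i).
pose f p := (osc_cos mu freq_data (thst K) p ^+ 2 + osc_sin mu freq_data (thst K) p ^+ 2) ^+ 2.
have mf : measurable_fun setT f.
  by apply: measurable_funX; exact: (measurable_osc_sqr mu mg (@measurable_thst R n K)).
have f0 p : 0 <= f p by exact: sqr_ge0.
apply: le_trans (weight_limit mf f0 _); last first.
  by move=> del d0; exact: weighted_L4_bound.
rewrite le_eqVlt; apply/orP; left; apply/eqP.
apply: eq_integral => t _; apply: eq_integral => x _; apply: eq_integral => y _.
by rewrite /f evol_reE evol_imE.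
Qed.

(** In the constant, [expR 1] comes from the time weight, [256 * pi] from Schur's test,
    [1 + (4 * eps)^-1] from the logarithm and 7 from the number of frequencies. *)
Lemma strichartz_L4 (eps : R) : 0 < eps ->
  (L4norm_evol chi N Fr Fi <=
   ((256 * expR 1 * pi * (1 + (4 * eps)^-1) * 7 `^ (4 * eps)) `^ 4^-1 * N `^ eps)%:E *
   L2norm_P chi N Fr Fi)%E.
Proof.
move=> eps0; rewrite /L4norm_evol /L2norm_P.
have e40 : 0 < 4 * eps by rewrite mulr_gt0.
have N0 : 0 < N by exact: lt_le_trans N1.
set D := 256 * expR 1 * pi * _ * _.
have D0 : 0 < D.
  rewrite /D !mulr_gt0 ?expR_gt0 ?pi_gt0 ?powR_gt0//.
  by rewrite ltr_pwDl// invr_ge0 ltW.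
have C0 : 0 < D `^ 4^-1 * N `^ eps by rewrite mulr_gt0 ?powR_gt0.
have X0 : 0 <= X by apply: sumr_ge0 => i _; apply: Rintegral_ge0 => x _; exact: sqr_ge0.
have HD : expR 1 * (256 * pi * harmonic_sum R n * X ^+ 2) <= D * N `^ (4 * eps) * X ^+ 2.
  rewrite [leLHS]mulrA ler_wpM2r ?sqr_ge0// !mulrA.
  have h1 : harmonic_sum R n <= (1 + (4 * eps)^-1) * (7 `^ (4 * eps) * N `^ (4 * eps)).
    apply: (le_trans (harmonic_sum_powR _ e40)).
    rewrite ler_wpM2l ?addr_ge0 ?invr_ge0 ?(ltW e40)// -powRM ?(ltW N0)//.
    by apply: ge0_ler_powR; rewrite ?nnegrE ?(ltW e40) ?mulr_ge0 ?(ltW N0) ?bigK_le.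
  have c0 : 0 <= expR 1 * 256 * pi :> R by rewrite !mulr_ge0 ?expR_ge0 ?pi_ge0.
  apply: le_trans (ler_wpM2l c0 h1) _.
  rewrite le_eqVlt; apply/orP; left; apply/eqP; rewrite /D.
  by move: (_ `^ _) (_ `^ _) (_^-1) (@pi R) (expR 1) => *; ring.
have L4 := evol_L4_le; have L2 := data_L2_le.
set S := (\int[mu]_x \int[mu]_(y in _) (_ + _)%:E)%E in L2 *.
set L := (\int[mu]_(t in _) _)%E in L4 *.
have L0 : (0 <= L)%E.
  apply: integral_ge0 => t _; apply: integral_ge0 => x _; apply: integral_ge0 => y _.
  by rewrite lee_fin sqr_ge0.
(* An infinite norm at time 0 makes the right side [+oo], as the constant is positive; [-oo]
   contradicts [L2]. *)
case: S L2 => [s| |] L2 //; last first.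
  rewrite poweRyr ?invr_eq0 ?pnatr_eq0// gt0_muley ?leey// lte_fin//.
rewrite lee_fin in L2; have s0 : 0 <= s by exact: le_trans X0 L2.
have LD : (L <= (D * N `^ (4 * eps) * s ^+ 2)%:E)%E.
  apply: (le_trans L4); rewrite lee_fin; apply: (le_trans HD).
  apply: ler_wpM2l; first by rewrite mulr_ge0 ?powR_ge0 ?(ltW D0).
  by rewrite ler_sqr ?nnegrE.
have B0 : (0 <= (D * N `^ (4 * eps) * s ^+ 2)%:E)%E by exact: le_trans L0 LD.
apply: (@le_trans _ _ ((D * N `^ (4 * eps) * s ^+ 2)%:E `^ 4^-1)%E).
  apply: gt0_ler_poweR => //; rewrite in_itv/= leey andbT//.
by rewrite !poweR_EFin powR_quarter ?(ltW D0) ?(ltW N0)// -EFinM.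
Qed.

End assembly.

Theorem theorem3p1 (R : realType) (chi : R -> R) (hchi : cutoff chi) :
  forall eps : R, 0 < eps ->
  exists C : R, forall (N : R), 1 <= N ->
  forall (a b : R -> R -> R) (Fr Fi : R -> int -> R),
    L2M a b -> is_FT a b Fr Fi ->
    (L4norm_evol chi N Fr Fi <= (C * N `^ eps)%:E * L2norm_P chi N Fr Fi)%E.
Proof.
move=> eps eps0.
exists ((256 * expR 1 * pi * (1 + (4 * eps)^-1) * 7 `^ (4 * eps)) `^ 4^-1).
by move=> N N1 a b Fr Fi hab hF; exact: (strichartz_L4 hchi N1 hab hF eps0).
Qed.
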